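(* Let $(c,h)$ be in Case (1)(ii), i.e., $T(c,h)=\langle S_{r,s}(t)\mathbf 1_{c,h}\rangle$ with $t=\pm1$, $r\ne s$, $(c,h)=(c(\pm1),h_{r,s}(\pm1))$. Let $k\in\mathbb{Z}_{>0}$, let $W(c,h,k)(0)=\mathrm{span}\{u_1,\dots,u_k\}\cong U(c,h,k)=\mathbb{C}[x]/((x-h)^k)$ and let $W(c,h,k)=\mathfrak L_0(U(c,h,k))=M(c,h,k)/J(c,h,k)$. Then if $k\le\kappa_{r,s}^\pm$, $$J(c,h,k)=\Big\langle S_{r,s}(\pm1)u_n+\sum_{i=1}^{n-1}R_{r,s}^{\pm,i}u_{n-i}\ \Big|\ n=1,\dots,k\Big\rangle,$$ where the $R_{r,s}^{\pm,i}\in\mathcal R_{rs}$, $1\le i\leq\kappa_{r,s}^\pm-1$, are uniquely determined modulo $S_{r,s}(\pm1)$ (each $R^{\pm,i}_{r,s}$ by the defining system, once the preceding ones are fixed).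
   Context: $\mathcal{L}$ is the Virasoro algebra, basis $L_n$ ($n\in\mathbb{Z}$), $\mathbf c$ central, $[L_m,L_n]=(m-n)L_{m+n}+\frac{m^3-m}{12}\delta_{m+n,0}\mathbf c$; $\mathcal L^-=\mathrm{span}\{L_n:n<0\}$. $M(c,h)$ is the Verma module generated by $\mathbf 1_{c,h}$ with $L_0=h$, $\mathbf c=c$, $L_n\mathbf 1_{c,h}=0$ for $n>0$; $T(c,h)$ is its maximal proper submodule. $U(c,h,k)=\mathbb{C}[x]/((x-h)^k)$ is the module for the level zero Zhu algebra $\mathbb{C}[x]$ of the universal Virasoro vertex operator algebra $V_{Vir}(c,0)$ ($x$ acting as $L_0$), with Jordan basis $\{u_1,\dots,u_k\}$: $L_0u_1=hu_1$, $L_0u_j=hu_j+u_{j-1}$. $M(c,h,k)$ is the $\mathcal L$-module induced from $U(c,h,k)$ where $L_n$ ($n>0$) acts as $0$, $L_0$ as $x$, $\mathbf c$ as $c$, graded with $L_{-n_1}\cdots L_{-n_m}u$ in degree $n_1+\cdots+n_m$. $J(c,h,k)$ is the submodule of all $v\in M(c,h,k)$ such that $yv$ has zero degree-zero component for every $y\in\mathcal U(\mathcal L)$; $\mathfrak L_0(U(c,h,k))=M(c,h,k)/J(c,h,k)$. $\langle\cdot\rangle$ denotes the $\mathcal L$-submodule generated. For $r,s\in\mathbb{Z}_{>0}$, $t\in\mathbb{C}^\times$: $c(t)=13+6t+6t^{-1}$, $h_{r,s}(t)=\frac{1-r^2}{4}t+\frac{1-rs}{2}+\frac{1-s^2}{4}t^{-1}$.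 $S_{r,s}(t)\in\mathcal U(\mathcal L^-)$ is the degree $rs$ element, with coefficient of $L_{-1}^{rs}$ equal to $1$, such that $S_{r,s}(t)\mathbf 1_{c,h}$ is singular (killed by all $L_n$, $n>0$) in $M(c(t),h_{r,s}(t))$. $\mathcal R_d$, $d=rs$, is the degree $d$ part of $\mathcal U(\mathcal L^-)$ with PBW basis $\mathcal B_d=\{B_i\}$, $[R]_{\mathcal B_d}$ the coordinate vector of $R\in\mathcal R_d$. $\mathcal A_d(c,h)=(\langle B_i\mathbf 1_{c,h},B_j\mathbf 1_{c,h}\rangle)_{i,j}$ is the Gram matrix of the Shapovalov form (contravariant for $L_n^\dagger=L_{-n}$, $\langle\mathbf 1_{c,h},\mathbf 1_{c,h}\rangle=1$), with polynomial entries in $c,h$; $\mathcal A_d(x,y)$ is the same with formal variables. For $n\ge1$ consider the system, for $R_d^1,\dots,R_d^n\in\mathcal R_d$ with $R_d^n\ne0$: $$\sum_{j=i}^n\frac1{(j-i)!}\Big(\frac{\partial}{\partial y}\Big)^{j-i}\mathcal A_d(x,y)[R_d^j]_{\mathcal B_d}\Big|_{(x,y)=(c,h)}=0,\qquad i=1,\dots,n.\qquad( * )_n$$ In Case (1)(ii), $\kappa^\pm_{r,s}\in\{2,3,\dots\}\cup\{\infty\}$ is the largest $n$ for which $( * )_n$ is solvable with $R_d^n\ne0$ ($\infty$ if it is solvable for all $n$), and $R_{r,s}^{\pm,i}\in\mathcal R_d$ ($1\le i\le\kappa_{r,s}^\pm-1$) are elements such that for every $n\le\kappa^\pm_{r,s}$,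 $R_d^n=S_{r,s}(\pm1)$, $R_d^j=R_{r,s}^{\pm,n-j}$ ($1\le j\le n-1$) solves $( * )_n$. *)

(* Defs.v *)
From HB Require Import structures.
From mathcomp Require Import all_boot all_order all_algebra.
From mathcomp Require Import generic_quotient finmap.
From mathcomp Require Import boolp classical_sets.
From mathcomp Require Import monalg.
From mathcomp Require Export reals complex.

Set Implicit Arguments.
Unset Strict Implicit.
Unset Printing Implicit Defensive.

Import Order.TTheory GRing.Theory Num.Theory.

Local Open Scope ring_scope.
Local Open Scope quotient_scope.
Local Open Scope classical_set_scope.

Section Submodules.
Context {A : nzRingType} {V : lmodType A}.
Implicit Types N X : set V.

Definition is_submod N : Prop :=
  N 0 /\ forall (a : A) (v w : V), N v -> N w -> N (a *: v + w).

Definition submod_gen X : set V := smallest is_submod X.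

Definition is_max_proper_submod N : Prop :=
  [/\ is_submod N, N <> setT &
      forall N', is_submod N' -> N' <> setT -> N' `<=` N].

Lemma submod_gen_is_submod X : is_submod (submod_gen X).
Proof.
split=> [N [[]]//|a v w hv hw N hN].
by have [[_ h] _] := hN; apply: h; [exact: hv|exact: hw].
Qed.

End Submodules.

Section QuotientModule.
Context {A : nzRingType} {V : lmodType A} (X : set V).

Definition quotmod_rel : rel V := fun v w => `[< submod_gen X (v - w) >].

Let gen0 : submod_gen X 0. Proof. by have [] := submod_gen_is_submod X. Qed.
Let genZ a v w : submod_gen X v -> submod_gen X w -> submod_gen X (a *: v + w).
Proof. by have [_] := submod_gen_is_submod X; apply. Qed.
Let genN v : submod_gen X v -> submod_gen X (- v).
Proof. by move=> h; rewrite -[- v]addr0 -scaleN1r; apply: genZ. Qed.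

Lemma quotmod_rel_equiv : equiv_class_of quotmod_rel.
Proof.
split=> [v|v w|w v x].
- by apply/asboolP; rewrite subrr.
- by apply/asboolP/asboolP => /genN; rewrite opprB.
- move=> /asboolP h1 /asboolP h2; apply/asboolP.
  rewrite (_ : v - x = 1 *: (v - w) + (w - x)); last by rewrite scale1r subrKA.
  exact: genZ.
Qed.

Canonical quotmod_equiv := EquivRelPack quotmod_rel_equiv.
Canonical quotmod_encModRel := defaultEncModRel quotmod_rel.

Definition quotmod : Type := {eq_quot quotmod_rel}.

HB.instance Definition _ : EqQuotient V quotmod_rel quotmod :=
  EqQuotient.on quotmod.
HB.instance Definition _ := Choice.on quotmod.

Lemma quotmod_eqP v w :
  \pi_quotmod v = \pi_quotmod w <-> submod_gen X (v - w).
Proof.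
split=> [/eqP|h]; first by rewrite eqmodE => /asboolP.
by apply/eqP; rewrite eqmodE; apply/asboolP.
Qed.

Let gen_repr v : submod_gen X (v - repr (\pi_quotmod v)).
Proof. by apply/quotmod_eqP; rewrite reprK. Qed.

Definition quotmod_zero : quotmod := lift_cst quotmod 0.
Definition quotmod_opp := lift_op1 quotmod -%R.
Definition quotmod_add := lift_op2 quotmod +%R.
Definition quotmod_scale (a : A) := lift_op1 quotmod ( *:%R a).

Canonical pi_quotmod_zero := PiConst quotmod_zero.

Lemma pi_quotmod_opp : {morph \pi_quotmod : v / - v >-> quotmod_opp v}.
Proof.
move=> v; unlock quotmod_opp; apply/quotmod_eqP.
by rewrite -opprD; apply: genN.
Qed.
Canonical pi_quotmod_opp_morph := PiMorph1 pi_quotmod_opp.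

Lemma pi_quotmod_add : {morph \pi_quotmod : v w / v + w >-> quotmod_add v w}.
Proof.
move=> v w; unlock quotmod_add; apply/quotmod_eqP.
by rewrite opprD addrACA -[v - _]scale1r; apply: genZ.
Qed.
Canonical pi_quotmod_add_morph := PiMorph2 pi_quotmod_add.

Lemma pi_quotmod_scale a :
  {morph \pi_quotmod : v / a *: v >-> quotmod_scale a v}.
Proof.
move=> v; unlock quotmod_scale; apply/quotmod_eqP.
by rewrite -scalerBr -[X in submod_gen _ X]addr0; apply: genZ.
Qed.
Canonical pi_quotmod_scale_morph a := PiMorph1 (pi_quotmod_scale a).

Lemma quotmod_addA : associative quotmod_add.
Proof. by move=> x y z; rewrite -[x]reprK -[y]reprK -[z]reprK !piE addrA. Qed.
Lemma quotmod_addC : commutative quotmod_add.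
Proof. by move=> x y; rewrite -[x]reprK -[y]reprK !piE addrC. Qed.
Lemma quotmod_add0 : left_id quotmod_zero quotmod_add.
Proof. by move=> x; rewrite -[x]reprK !piE add0r. Qed.
Lemma quotmod_addN : left_inverse quotmod_zero quotmod_opp quotmod_add.
Proof. by move=> x; rewrite -[x]reprK !piE addNr. Qed.

HB.instance Definition _ := GRing.isZmodule.Build quotmod
  quotmod_addA quotmod_addC quotmod_add0 quotmod_addN.

Lemma quotmod_scaleA a b (x : quotmod) :
  quotmod_scale a (quotmod_scale b x) = quotmod_scale (a * b) x.
Proof. by rewrite -[x]reprK !piE scalerA. Qed.
Lemma quotmod_scale1 : left_id 1 quotmod_scale.
Proof. by move=> x; rewrite -[x]reprK !piE scale1r. Qed.
Lemma quotmod_scaleDr : right_distributive quotmod_scale +%R.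
Proof.
move=> a x y; rewrite -[x]reprK -[y]reprK.
by rewrite -[_ + _]pi_quotmod_add !piE scalerDr pi_quotmod_add.
Qed.
Lemma quotmod_scaleDl x : {morph quotmod_scale^~ x : a b / a + b}.
Proof. by move=> a b; rewrite -[x]reprK !piE scalerDl pi_quotmod_add. Qed.

HB.instance Definition _ := GRing.Zmodule_isLmodule.Build A quotmod
  quotmod_scaleA quotmod_scale1 quotmod_scaleDr quotmod_scaleDl.

End QuotientModule.

Section Virasoro.
Context (F : fieldType).

(* [Some n] is L_n and [None] is the central element. *)
Definition vir_index : Type := option int.
HB.instance Definition _ := Choice.on vir_index.

(* The tensor algebra of the Virasoro algebra. *)
Definition vir_tensor : Type := {malg F[{fmonom vir_index}]}.
HB.instance Definition _ := GRing.Lalgebra.on vir_tensor.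

Definition vir_gen (a : vir_index) : vir_tensor :=
  mkmalgU (fmu a : {fmonom vir_index}) 1.

Definition vir_bracket (a b : vir_index) : vir_tensor :=
  match a, b with
  | Some m, Some n =>
      (m - n)%:~R *: vir_gen (Some (m + n)) +
      (if m + n == 0 then ((m ^+ 3 - m)%:~R / 12) *: vir_gen None else 0)
  | _, _ => 0
  end.

Definition is_two_sided_ideal (I : set vir_tensor) : Prop :=
  [/\ I 0, forall x y, I x -> I y -> I (x + y) &
      forall a x b, I x -> I (a * x * b)].

Definition vir_ideal : set vir_tensor :=
  smallest is_two_sided_ideal
    [set vir_gen ab.1 * vir_gen ab.2 - vir_gen ab.2 * vir_gen ab.1 -
         vir_bracket ab.1 ab.2 | ab in [set: vir_index * vir_index]].

Definition Uvir : Type := quotmod vir_ideal.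
HB.instance Definition _ := GRing.Lmodule.on Uvir.
HB.instance Definition _ : EqQuotient _ (quotmod_rel vir_ideal) Uvir :=
  EqQuotient.on Uvir.

Lemma vir_ideal_two_sided : is_two_sided_ideal vir_ideal.
Proof.
split=> [I [[]]//|x y hx hy I hI|a x b hx I hI]; have [[_ hD hM] _] := hI.
  by apply: hD; [exact: hx|exact: hy].
by apply: hM; exact: hx.
Qed.

Lemma vir_ideal_submod : is_submod vir_ideal.
Proof.
have [h0 hD hM] := vir_ideal_two_sided; split=> // a v w hv hw.
by apply: hD => //; rewrite -[_ *: _]mulr1 -[v]mul1r scalerAl; apply: hM.
Qed.

Lemma pi_UvirP (x y : vir_tensor) :
  \pi_Uvir x = \pi_Uvir y <-> vir_ideal (x - y).
Proof.
by have := quotmod_eqP vir_ideal x y; rewrite /submod_gen smallest_id //;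
  exact: vir_ideal_submod.
Qed.

Let idealMl a x : vir_ideal x -> vir_ideal (a * x).
Proof.
by move=> h; rewrite -[_ * _]mulr1; have [_ _ hM] := vir_ideal_two_sided;
  apply: hM.
Qed.

Let idealMr a x : vir_ideal x -> vir_ideal (x * a).
Proof.
by move=> h; rewrite -[x]mul1r; have [_ _ hM] := vir_ideal_two_sided;
  apply: hM.
Qed.

Let ideal_repr x : vir_ideal (x - repr (\pi_Uvir x)).
Proof. by apply/pi_UvirP; rewrite reprK. Qed.

Definition Uvir_one : Uvir := \pi_Uvir (1 : vir_tensor).
Definition Uvir_mul := lift_op2 Uvir (@GRing.mul vir_tensor).

Lemma pi_Uvir_mul (x y : vir_tensor) :
  \pi_Uvir (x * y) = Uvir_mul (\pi_Uvir x) (\pi_Uvir y).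
Proof.
unlock Uvir_mul; apply/pi_UvirP; set x' := repr _; set y' := repr _.
rewrite (_ : _ - _ = (x - x') * y + x' * (y - y')); last first.
  by rewrite mulrBl mulrBr subrKA.
by have [_ hD _] := vir_ideal_two_sided; apply: hD;
  [apply: idealMr; apply: ideal_repr|apply: idealMl; apply: ideal_repr].
Qed.

Let pi_UvirD (x y : vir_tensor) :
  \pi_Uvir (x + y) = (\pi_Uvir x : Uvir) + \pi_Uvir y.
Proof. exact: pi_quotmod_add. Qed.

Let pi_UvirZ a (x : vir_tensor) :
  \pi_Uvir (a *: x) = a *: (\pi_Uvir x : Uvir).
Proof. exact: pi_quotmod_scale. Qed.

Lemma Uvir_mulA : associative Uvir_mul.
Proof.
elim/quotW=> x; elim/quotW=> y; elim/quotW=> z.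
by rewrite -!pi_Uvir_mul mulrA.
Qed.
Lemma Uvir_mul1 : left_id Uvir_one Uvir_mul.
Proof. by elim/quotW=> x; rewrite -pi_Uvir_mul mul1r. Qed.
Lemma Uvir_mulr1 : right_id Uvir_one Uvir_mul.
Proof. by elim/quotW=> x; rewrite -pi_Uvir_mul mulr1. Qed.
Lemma Uvir_mulDl : left_distributive Uvir_mul +%R.
Proof.
elim/quotW=> x; elim/quotW=> y; elim/quotW=> z.
by rewrite -pi_UvirD -!pi_Uvir_mul mulrDl pi_UvirD.
Qed.
Lemma Uvir_mulDr : right_distributive Uvir_mul +%R.
Proof.
elim/quotW=> x; elim/quotW=> y; elim/quotW=> z.
by rewrite -pi_UvirD -!pi_Uvir_mul mulrDr pi_UvirD.
Qed.

Lemma Uvir_one_neq0 : Uvir_one != 0.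
Proof.
apply/eqP; rewrite (_ : 0 = \pi_Uvir (0 : vir_tensor)); last first.
  by rewrite -[0 in RHS](scale0r 0) pi_UvirZ scale0r.
move=> /pi_UvirP; rewrite subr0 => h1.
pose T := {malg F[{fmonom vir_index}]}.
pose eps : {rmorphism T -> F} := mcoeff (@mone {fmonom vir_index}).
have epsZ a (x : T) : eps (a *: x) = a * eps x by exact: mcoeffZ.
suff : [set x : T | eps x = 0] 1.
  by move/eqP; rewrite rmorph1 oner_eq0.
apply: h1; split.
  split=> [|x y hx hy|a x b hx] /=; first exact: raddf0.
    by rewrite [LHS](rmorphD eps) [eps x]hx [eps y]hy addr0.
  by rewrite [LHS](rmorphM eps) (rmorphM eps a x) [eps x]hx mulr0 mul0r.
have gen0 a : eps (vir_gen a) = 0.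
  by rewrite [LHS]mcoeffU -[_ == _]val_eqE /= fmU fm1.
move=> _ [[a b] _ <-] /=.
rewrite [LHS](rmorphB eps) (rmorphB eps) !(rmorphM eps) !gen0 mul0r subrr sub0r.
case: a b => [m|] [n|] /=; rewrite ?[eps 0](raddf0 eps) ?oppr0 //.
rewrite (rmorphD eps) epsZ gen0 mulr0 add0r.
by case: ifP => _; rewrite ?epsZ ?gen0 ?mulr0 ?(raddf0 eps) oppr0.
Qed.

HB.instance Definition _ := GRing.Zmodule_isNzRing.Build Uvir
  Uvir_mulA Uvir_mul1 Uvir_mulr1 Uvir_mulDl Uvir_mulDr Uvir_one_neq0.

Lemma Uvir_scaleAl (a : F) (x y : Uvir) : a *: (x * y) = a *: x * y.
Proof.
elim/quotW: x => x; elim/quotW: y => y.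
rewrite -[_ * _]pi_Uvir_mul -!pi_UvirZ.
by rewrite -[RHS]pi_Uvir_mul scalerAl.
Qed.

HB.instance Definition _ := GRing.Lmodule_isLalgebra.Build F Uvir Uvir_scaleAl.

Let malg_scaleAr (a : F) (x y : {malg F[{fmonom vir_index}]}) :
  a *: (x * y) = x * (a *: y).
Proof.
apply/malgP => m; rewrite mcoeffZ.
rewrite (mcoeffMl x y) (mcoeffMlw _ (fsubset_refl _) (msuppZ_le a y)).
rewrite mulr_sumr; apply: eq_bigr => m1 _.
rewrite mulr_sumr; apply: eq_bigr => m2 _.
by rewrite mcoeffZ mulrnAr mulrCA.
Qed.

Lemma Uvir_scaleAr (a : F) (x y : Uvir) : a *: (x * y) = x * (a *: y).
Proof.
elim/quotW: x => x; elim/quotW: y => y.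
rewrite -[_ * _]pi_Uvir_mul -!pi_UvirZ.
by rewrite -[RHS]pi_Uvir_mul; congr (\pi_Uvir _); apply: malg_scaleAr.
Qed.

HB.instance Definition _ := GRing.Lalgebra_isAlgebra.Build F Uvir Uvir_scaleAr.

Definition vL (n : int) : Uvir := \pi_Uvir (vir_gen (Some n)).
Definition vC : Uvir := \pi_Uvir (vir_gen None).

(* The degree d part of U(L^-), L_{-n} having degree n. *)
Definition Uneg_deg (d : nat) : set Uvir :=
  @submod_gen F Uvir
    [set \prod_(n <- s) vL (- n%:Z)
       | s in [set s : seq nat | all (ltn 0) s /\ sumn s = d]].

End Virasoro.

Section InducedModules.
Context {F : fieldType} {V : lmodType F} (X : V -> V) (c : F).

Local Notation U := (Uvir F).
Local Notation free := {malg U[V]}.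

(* U(L) (x)_{U(L_{>=0})} V, where L_n (n > 0) acts on V as 0, L_0 as X and   *)
(* the central element as c: the free U(L)-module on the set V, modulo the   *)
(* relations of the tensor product over F (first two lines) and those        *)
(* balancing the action of L_{>=0}.                                          *)
Definition ind_rel : set free :=
  [set mkmalgU (v.1 + v.2) 1 - mkmalgU v.1 1 - mkmalgU v.2 1
     | v in [set: V * V]] `|`
  [set mkmalgU (av.1 *: av.2) 1 - mkmalgU av.2 av.1%:A | av in [set: F * V]] `|`
  [set mkmalgU nv.2 (vL F nv.1) | nv in [set nv : int * V | 0 < nv.1]] `|`
  [set mkmalgU v (vL F 0) - mkmalgU (X v) 1 | v in [set: V]] `|`
  [set mkmalgU v (vC F) - mkmalgU v c%:A | v in [set: V]].

Definition ind : Type := quotmod ind_rel.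
HB.instance Definition _ := GRing.Lmodule.on ind.

Definition ind_in (v : V) : ind := \pi_(quotmod ind_rel) (mkmalgU v 1).

Definition ind_deg (d : nat) : set ind :=
  [set w | exists m (y : 'I_m -> U) (v : 'I_m -> V),
     (forall i, Uneg_deg d (y i)) /\ w = \sum_i y i *: ind_in (v i)].

Definition zero_deg0_component (w : ind) : Prop :=
  exists N (w_ : nat -> ind),
    [/\ forall d, ind_deg d (w_ d), w = \sum_(d < N) w_ d & w_ 0%N = 0].

Definition ind_J : set ind :=
  [set w | forall y : U, zero_deg0_component (y *: w)].

End InducedModules.

Section Modules.
Context {F : fieldType}.
Implicit Types (c h : F) (k d n m : nat).

Definition Zhu_mod h k : Type := {poly %/ ('X - h%:P) ^+ k}.
HB.instance Definition _ h k := Vector.on (Zhu_mod h k).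

Definition Zhu_X h k (v : Zhu_mod h k) : Zhu_mod h k :=
  ('qX : {poly %/ ('X - h%:P) ^+ k}) * v.

(* u_1, ..., u_k; the values of u outside 1, ..., k are irrelevant. *)
Definition is_Jordan_basis h k (u : nat -> Zhu_mod h k) : Prop :=
  [/\ basis_of {:Zhu_mod h k} [seq u j | j <- iota 1 k],
      Zhu_X (u 1%N) = h *: u 1%N &
      forall j, (1 < j <= k)%N -> Zhu_X (u j) = h *: u j + u j.-1].

Definition Mk c h k : Type := ind (@Zhu_X h k) c.
HB.instance Definition _ c h k := GRing.Lmodule.on (Mk c h k).

Definition Mk_in c h k (v : Zhu_mod h k) : Mk c h k := ind_in (@Zhu_X h k) c v.

Definition Jk c h k : set (Mk c h k) := @ind_J F _ (@Zhu_X h k) c.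

Definition Verma c h : Type := @ind F F^o (fun v => h *: v) c.
HB.instance Definition _ c h := GRing.Lmodule.on (Verma c h).

Definition hwv c h : Verma c h := ind_in _ _ (1 : F^o).

Definition is_part d (s : seq nat) : bool :=
  [&& sorted geq s, 0%N \notin s & sumn s == d].

(* A partition of d has at most d parts, all of them at most d. *)
Definition part d : predArgType :=
  {p : d.-bseq 'I_d.+1 | is_part d [seq val i | i <- p]}.
HB.instance Definition _ d := Finite.on (part d).

Definition part_seq d (p : part d) : seq nat := [seq nat_of_ord i | i <- val p].

Definition pbw d (p : part d) : Uvir F :=
  \prod_(n <- part_seq p) vL F (- n%:Z).

Definition pbw_coord d (x : Uvir F) : 'cV[F]_#|part d| :=
  xget 0 [set v : 'cV[F]_#|part d| | x = \sum_i v i 0 *: pbw (enum_val i)].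

Definition is_Shapovalov c h (f : Verma c h -> Verma c h -> F) : Prop :=
  [/\ forall a v v' w, f (a%:A *: v + v') w = a * f v w + f v' w,
      forall a v w w', f v (a%:A *: w + w') = a * f v w + f v w',
      forall (n : int) v w, f (vL F n *: v) w = f v (vL F (- n) *: w) &
      f (hwv c h) (hwv c h) = 1].

Definition Shapovalov c h : Verma c h -> Verma c h -> F :=
  xget (fun _ _ => 0) (@is_Shapovalov c h).

(* Polynomials in x, y are elements of F[x][y]: the outer variable is y. *)
Definition eval2 (p : {poly {poly F}}) (x y : F) : F := p.[y%:P].[x].

Definition Gram d : 'M[{poly {poly F}}]_#|part d| :=
  xget 0 [set A : 'M[{poly {poly F}}]_#|part d| | forall c h i j,
    eval2 (A i j) c h = Shapovalov (pbw (enum_val i) *: hwv c h)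
                                   (pbw (enum_val j) *: hwv c h)].

(* (d/dy)^m of the Gram matrix, evaluated at (x, y) = (c, h). *)
Definition dGram d m c h : 'M[F]_#|part d| :=
  map_mx (fun p : {poly {poly F}} => eval2 p^`(m) c h) (Gram d).

Definition system d c h n (Rd : nat -> Uvir F) : Prop :=
  forall i, (1 <= i <= n)%N ->
    \sum_(i <= j < n.+1)
      ((j - i)`!%:R)^-1 *: (dGram d (j - i) c h *m pbw_coord d (Rd j)) = 0.

Definition solvable d c h n : Prop :=
  exists Rd : nat -> Uvir F,
    [/\ forall j, (1 <= j <= n)%N -> Uneg_deg d (Rd j), Rd n <> 0 &
        system d c h n Rd].

(* [None] stands for infinity. *)
Definition le_kappa n (kappa : option nat) : bool :=
  if kappa is Some m then (n <= m)%N else true.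

Definition is_kappa d c h (kappa : option nat) : Prop :=
  if kappa is Some m then
    [/\ (0 < m)%N, solvable d c h m &
        forall n, (0 < n)%N -> solvable d c h n -> (n <= m)%N]
  else forall n, (0 < n)%N -> solvable d c h n.

Definition c_t (t : F) : F := 13 + 6 * t + 6 * t^-1.

Definition h_rs (r s : nat) (t : F) : F :=
  (1 - r%:R ^+ 2) / 4 * t + (1 - r%:R * s%:R) / 2 + (1 - s%:R ^+ 2) / 4 * t^-1.

Definition is_S (r s : nat) (t : F) (S : Uvir F) : Prop :=
  [/\ Uneg_deg (r * s) S,
      forall p : part (r * s), part_seq p = nseq (r * s) 1%N ->
        pbw_coord (r * s) S (enum_rank p) 0 = 1 &
      forall n : int, 0 < n ->
        vL F n *: (S *: hwv (c_t t) (h_rs r s t)) = 0].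

(* The unknowns R_d^1, ..., R_d^n of the system, with R_d^n = S and          *)
(* R_d^j = R^{n - j} for j < n.                                              *)
Definition Rseq (S : Uvir F) (R : nat -> Uvir F) n (j : nat) : Uvir F :=
  if j == n then S else R (n - j)%N.

Definition is_R d c h (kappa : option nat) (S : Uvir F) (R : nat -> Uvir F) :
    Prop :=
  (forall i, (0 < i)%N -> le_kappa i.+1 kappa -> Uneg_deg d (R i)) /\
  (forall n, (0 < n)%N -> le_kappa n kappa -> system d c h n (Rseq S R n)).

End Modules.

Arguments Jk {F} c h k.
Arguments Mk_in {F} c {h k} v.

(* Main.v *)
Require Import Defs.
From HB Require Import structures.
From mathcomp Require Import all_boot all_order all_algebra.
From mathcomp Require Import ssrAC zify ring.
From mathcomp Require Import generic_quotient finmap.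
From mathcomp Require Import boolp classical_sets reals complex.
From mathcomp Require Import monalg.

Set Implicit Arguments.
Unset Strict Implicit.
Unset Printing Implicit Defensive.

Import Order.TTheory GRing.Theory Num.Theory.
Local Open Scope ring_scope.
Local Open Scope quotient_scope.
Local Open Scope classical_set_scope.
Local Open Scope complex_scope.

(** Let chi : U(L) -> F[x, y] be the Harish-Chandra projection: when z is
    written with the lowering letters L_{-n} on the left and the raising
    letters on the right, chi z is the part made only of the central element
    and of L_0, read as x and y. The degree zero component of z u, for u in
    U(c,h,k), is chi z evaluated at x = c and at y = the action of L_0 on u.
    As L_0 - h lowers the index of the Jordan basis by one, Taylor's formula
    in y gives the coefficient of u_l in the degree zero component of
    z (sum_j R_j u_j): it is

      sum_(j >= l) 1/(j-l)! (d/dy)^(j-l) chi (z R_j) at (x, y) = (c, h)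

    ([vac_comb]). When the R_j have degree d, it is enough to let z run over
    the adjoints B^dagger of the PBW monomials B of degree d
    ([triangular_ind]), and the entries of the Gram matrix are the polynomials
    chi (B_i^dagger B_j) ([GramE]). The defining system therefore says exactly
    that the given generators lie in J(c,h,k) ([system_taylor],
    [comb_radical]).

    Conversely let sum_(j <= n) y_j u_j lie in J(c,h,k). The coefficient of
    u_n shows that chi (z y_n) vanishes at (c,h) for every z. The vectors
    y 1_{c,h} with this property form a proper submodule of the Verma module,
    so y_n 1_{c,h} lies in T(c,h) and equals a S 1_{c,h} for some a in U(L)
    ([chi_radical]). Subtracting a times the n-th generator leaves terms in
    u_1, ..., u_(n-1), plus (y_n - a S) u_n. The annihilator of 1_{c,h} is the
    left ideal generated by the L_m (m > 0), by L_0 - h and by the difference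
    of the central element and c; each of these maps u_n into the span of the lower u_j; so an induction on n
    applies ([radical_sub_gen]).

    Two choices of R^i differ by an element D of degree d such that
    chi (B^dagger D) vanishes at (c,h) for all B. So D 1_{c,h} lies in
    T(c,h), hence is a scalar multiple of S 1_{c,h} for reasons of degree, and
    D is that multiple of S because U(L^-) acts freely on 1_{c,h}
    ([radical_degree_d]).

    The existence of chi and this freeness both come from the
    Poincare-Birkhoff-Witt theorem, proved by straightening words: a function
    given on sorted words extends to all words compatibly with the
    commutation relations ([nf_exchange]), hence defines a linear map on U(L)
    ([Uvir_lift]). *)

(** * Words and their straightening *)

Section Straightening.
Context {I : eqType} (le : rel I).
Hypothesis le_tot : total le.
Implicit Types (a b x : I) (u v w m : seq I).

Fixpoint inversions w : nat :=
  if w is a :: w' then (count (fun b => ~~ le a b) w' + inversions w')%N else 0%N.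

(** Exchanging a descent removes one inversion, while a bracket shortens the
    word and may create inversions; there are at most n ^ 2 of them in a word
    of size n, which the cube outweighs. *)
Definition word_measure w : nat := (size w ^ 3 + inversions w)%N.

Lemma inversions_le w : (inversions w <= size w ^ 2)%N.
Proof.
elim: w => //= a w IH; have := count_size (fun b => ~~ le a b) w.
by rewrite !expnS !expn0 in IH *; nia.
Qed.

Lemma word_measure_short w w' :
  (size w < size w')%N -> (word_measure w < word_measure w')%N.
Proof.
rewrite /word_measure => h; have := inversions_le w.
move: (inversions w) (inversions w') => i i' hi.
suff : (size w ^ 3 + size w ^ 2 < size w' ^ 3)%N by lia.
have : ((size w).+1 ^ 3 <= size w' ^ 3)%N by rewrite leq_exp2r.
by apply: leq_trans; rewrite !expnS !expn0; nia.
Qed.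

Lemma count_swap (p : pred I) u a b v :
  count p (u ++ b :: a :: v) = count p (u ++ a :: b :: v).
Proof. by rewrite !count_cat /=; lia. Qed.

Lemma word_measure_swap u a b v : ~~ le a b ->
  (word_measure (u ++ b :: a :: v) < word_measure (u ++ a :: b :: v))%N.
Proof.
move=> hab; rewrite /word_measure !size_cat /= ltn_add2l.
elim: u => [|x u IH] /=; last by rewrite count_swap ltn_add2l.
have : le b a by have := le_tot a b; rewrite (negbTE hab).
by rewrite hab => -> /=; lia.
Qed.

Lemma word_measure_drop u l a b v :
  (word_measure (u ++ l :: v) < word_measure (u ++ a :: b :: v))%N.
Proof. by apply: word_measure_short; rewrite !size_cat /= ltn_add2l. Qed.

Lemma word_measure_ind (P : seq I -> Prop) :
  (forall w, (forall w', (word_measure w' < word_measure w)%N -> P w') -> P w) ->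
  forall w, P w.
Proof.
move=> H w; have [n] := ubnP (word_measure w); elim: n w => // n IH w hw.
by apply: H => w' hw'; apply: IH; apply: leq_trans hw' _.
Qed.

Fixpoint first_descent w : option (seq I * I * I * seq I) :=
  if w is a :: w' then
    if w' is b :: v then
      if le a b then
        omap (fun d => (a :: d.1.1.1, d.1.1.2, d.1.2, d.2)) (first_descent w')
      else Some ([::], a, b, v)
    else None
  else None.

Variant first_descent_spec w : option (seq I * I * I * seq I) -> Type :=
  | NoDescent of sorted le w : first_descent_spec w None
  | Descent u a b v of w = u ++ a :: b :: v & sorted le (rcons u a)
      & ~~ le a b : first_descent_spec w (Some (u, a, b, v)).

Lemma first_descentP w : first_descent_spec w (first_descent w).
Proof.
elim: w => [|a [|b v] IH]; [by constructor|by constructor|].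
have -> : first_descent (a :: b :: v) = if le a b then
    omap (fun d => (a :: d.1.1.1, d.1.1.2, d.1.2, d.2)) (first_descent (b :: v))
  else Some ([::], a, b, v) by [].
case: ifPn => hab; last by apply: (@Descent _ [::]).
case: IH => [hs|u a' b' v' e hu hab'] /=.
  by constructor; rewrite /= hab.
apply: Descent => //=; first by rewrite e.
by case: u e hu => [|x u] /= [<- _] => [_|->]; rewrite hab.
Qed.

(** The possible positions of a descent a' b' with respect to the first
    descent a b of a word. *)
Variant two_descents u a b v u' a' b' v' : Prop :=
  | SameDescent of u = u' & a = a' & b = b' & v = v'
  | NextDescent of u' = rcons u a & a' = b & v = b' :: v'
  | FarDescent m of u' = u ++ a :: b :: m & v = m ++ a' :: b' :: v'.

Lemma two_descentsP u a b v u' a' b' v' :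
  u ++ a :: b :: v = u' ++ a' :: b' :: v' -> sorted le (rcons u a) ->
  ~~ le a' b' -> two_descents u a b v u' a' b' v'.
Proof.
move=> e hs hd.
elim: u u' e hs => [|x u IH] [|x' u'] /=.
- by case=> -> -> -> _; constructor.
- case: u' => [|y u'] /= [<-].
    by case=> <- -> _; apply: NextDescent.
  by case=> <- -> _; apply: FarDescent.
- by case: u IH => [|y u] IH /= [-> -> _]; rewrite (negbTE hd).
- case=> <- e /path_sorted hs.
  case: (IH _ e hs) => [-> -> -> ->|-> -> ->|m -> ->].
  + exact: SameDescent.
  + exact: NextDescent.
  + by apply: FarDescent.
Qed.

Lemma unsorted_descent w : ~~ sorted le w ->
  exists u a b v, w = u ++ a :: b :: v /\ ~~ le a b.
Proof.
by case: (first_descentP w) => [->|u a b v e _ h _] //; exists u, a, b, v.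
Qed.

(** The induction used for all properties of normal forms: the rewriting rules
    replace an unsorted word by a less inverted one and by shorter ones. *)
Lemma word_ind (P : seq I -> Prop) :
  (forall w, sorted le w -> (forall w', (size w' < size w)%N -> P w') -> P w) ->
  (forall u a b v, ~~ le a b ->
     (forall w', (size w' < size (u ++ a :: b :: v))%N -> P w') ->
     P (u ++ b :: a :: v) -> P (u ++ a :: b :: v)) ->
  forall w, P w.
Proof.
move=> Ps Pu; apply: word_measure_ind => w IH.
have IHs w' : (size w' < size w)%N -> P w'.
  by move=> h; apply: IH; apply: word_measure_short.
have [hs|/unsorted_descent[u [a [b [v [e hab]]]]]] := boolP (sorted le w).
  exact: Ps.
rewrite e in IH IHs *; apply: Pu => //; apply: IH.
exact: word_measure_swap.
Qed.

End Straightening.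

(** * The Poincare-Birkhoff-Witt theorem *)

Section PBW.
Context {F : comNzRingType} {I : eqType} (le : rel I).
Hypotheses (le_tot : total le) (le_anti : antisymmetric le)
  (le_tr : transitive le).
Context (br : I -> I -> seq (F * I)).

(** The bracket is given by structure constants; [brsum phi a b] is the value
    on [a, b] of the linear extension of phi. *)
Definition brsum (W : lmodType F) (phi : I -> W) a b : W :=
  \sum_(p <- br a b) p.1 *: phi p.2.

Hypothesis brsum_refl : forall (W : lmodType F) (phi : I -> W) a, brsum phi a a = 0.
Hypothesis brsum_anti : forall (W : lmodType F) (phi : I -> W) a b,
  brsum phi a b = - brsum phi b a.
Hypothesis brsum_jacobi : forall (W : lmodType F) (phi : I -> W) a b c,
  brsum (fun l => brsum phi l c) a b + brsum (fun l => brsum phi l a) b c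
  + brsum (fun l => brsum phi l b) c a = 0.

Context {W : lmodType F}.
Implicit Types (a b c : I) (u v w m : seq I) (f : seq I -> W).

Lemma brsumD (phi psi : I -> W) a b :
  brsum (fun l => phi l + psi l) a b = brsum phi a b + brsum psi a b.
Proof. by rewrite /brsum -big_split /=; apply: eq_bigr => p _; rewrite scalerDr. Qed.

Lemma eq_brsum (phi psi : I -> W) a b :
  phi =1 psi -> brsum phi a b = brsum psi a b.
Proof. by move=> e; apply: eq_bigr => p _; rewrite e. Qed.

(** The relation a b = b a + [a, b], inside the word u _ v, for the linear map
    with values f on words. *)
Definition exchange_at f u a b v : Prop :=
  f (u ++ a :: b :: v) =
  f (u ++ b :: a :: v) + brsum (fun l => f (u ++ l :: v)) a b.

Lemma exchange_sym f u a b v : exchange_at f u b a v -> exchange_at f u a b v.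
Proof. by rewrite /exchange_at brsum_anti => ->; rewrite addrNK. Qed.

Lemma brsum_exchange (f : I -> I -> W) a b c d :
  brsum (fun l => brsum (fun l' => f l l') c d) a b =
  brsum (fun l' => brsum (fun l => f l l') a b) c d.
Proof.
rewrite /brsum; under eq_bigr do rewrite scaler_sumr.
rewrite exchange_big /=; apply: eq_bigr => q _.
by rewrite scaler_sumr; apply: eq_bigr => p _; rewrite !scalerA mulrC.
Qed.

Section NormalForm.
Context (e : seq I -> W).

(** The normal form obtained by always rewriting the first descent; the
    natural number is only the fuel of the recursion. *)
Fixpoint nf_rec n w : W :=
  if n is n'.+1 then
    if first_descent le w is Some (u, a, b, v) then
      nf_rec n' (u ++ b :: a :: v) + brsum (fun l => nf_rec n' (u ++ l :: v)) a b
    else e w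
  else 0.

Definition nf w : W := nf_rec (word_measure le w).+1 w.

Lemma nf_rec_nf n w : (word_measure le w < n)%N -> nf_rec n w = nf w.
Proof.
have [k] := ubnP (word_measure le w); elim: k n w => // k IH [|n] w //= hk hn.
rewrite /nf /=; case: first_descentP => [//|u a b v ew _ hab].
have hs := word_measure_swap le_tot u v hab.
have hd l := word_measure_drop le u l a b v.
rewrite -ew in hs hd.
rewrite !IH //; [|lia..].
congr (_ + _); apply: eq_brsum => l; have := hd l => ?.
by rewrite !IH //; lia.
Qed.

Lemma nf_sorted w : sorted le w -> nf w = e w.
Proof.
rewrite /nf /=; case: first_descentP => // u a b v -> _ hab.
by move=> /cat_sorted2[_] /= /andP[hab']; rewrite hab' in hab.
Qed.

Lemma nf_first w u a b v :
  first_descent le w = Some (u, a, b, v) ->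
  nf w = nf (u ++ b :: a :: v) + brsum (fun l => nf (u ++ l :: v)) a b.
Proof.
move=> ef; rewrite {1}/nf /= ef; move: ef.
case: first_descentP => // u' a' b' v' ew _ hab [<- <- <- <-].
rewrite nf_rec_nf ?ew ?word_measure_swap //; congr (_ + _).
by apply: eq_brsum => l; rewrite nf_rec_nf // word_measure_drop.
Qed.

(** The normal form does not depend on which descent is rewritten. By
    induction on the measure, another descent is compared with the first one:
    if they are disjoint, the two rewritings commute; if they overlap in
    a b c with a > b > c, both ways of sorting reach c b a, and the bracket
    terms agree by the Jacobi identity. *)
Lemma nf_exchange u a b v : exchange_at nf u a b v.
Proof.
suff H w u' a' b' v' : w = u' ++ a' :: b' :: v' -> ~~ le a' b' ->
    exchange_at nf u' a' b' v'.
  have [hab|hab] := boolP (le a b); last exact: H hab.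
  have [hba|hba] := boolP (le b a).
    have -> : a = b by apply: le_anti; rewrite hab.
    by rewrite /exchange_at brsum_refl addr0.
  by apply: exchange_sym; apply: H hba.
move: w u' a' b' v' {u a b v}; apply: (@word_measure_ind _ le) => w IH u' a' b' v' ew hab'.
have IH' u a b v : (word_measure le (u ++ a :: b :: v) < word_measure le w)%N ->
    ~~ le a b -> exchange_at nf u a b v by move=> h; exact: IH h _ _ _ _ erefl.
have IHs u a b v : (size (u ++ a :: b :: v) < size w)%N -> exchange_at nf u a b v.
  move=> hs; have hs' : (size (u ++ b :: a :: v) < size w)%N.
    by move: hs; rewrite !size_cat.
  have [hab|hab] := boolP (le a b); last first.
    by apply: IH' => //; apply: word_measure_short.
  have [hba|hba] := boolP (le b a).
    have -> : a = b by apply: le_anti; rewrite hab.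
    by rewrite /exchange_at brsum_refl addr0.
  by apply: exchange_sym; apply: IH' => //; apply: word_measure_short.
have := @nf_first w; case: first_descentP => [|u a b v ew2 hu hab].
  rewrite ew => /cat_sorted2[_] /= /andP[h]; by rewrite h in hab'.
move=> /(_ _ _ _ _ erefl) en.
have hsw := word_measure_swap le_tot u v hab; rewrite -ew2 in hsw.
have hsw' := word_measure_swap le_tot u' v' hab'; rewrite -ew in hsw'.
rewrite /exchange_at -ew en.
have [eu ea eb ev|eu ea ev|m eu ev] := two_descentsP (etrans (esym ew2) ew) hu hab'.
- by rewrite -eu -ea -eb -ev.
- (* The overlapping descents a b and b b'. *)
  subst u' a' v.
  have hac : ~~ le a b'.
    apply: contra hab' => h; apply: le_tr h.
    by have := le_tot a b; rewrite (negbTE hab).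
  move: hsw hsw' ew; rewrite !cat_rcons => hsw hsw' ew.
  have E1 : exchange_at nf (rcons u b) a b' v'.
    by apply: IH' => //; rewrite cat_rcons.
  have E2 : exchange_at nf u b b' (a :: v').
    apply: IH' => //; apply: ltn_trans hsw.
    by have := word_measure_swap le_tot (rcons u b) v' hac; rewrite !cat_rcons.
  have E3 : exchange_at nf u a b' (b :: v') by apply: IH'.
  have E4 : exchange_at nf (rcons u b') a b v'.
    apply: IH' => //; rewrite cat_rcons; apply: ltn_trans hsw'.
    by apply: word_measure_swap.
  rewrite /exchange_at !cat_rcons in E1 E2 E3 E4 *.
  rewrite E1 E2 E3 E4.
  pose phi l := nf (u ++ l :: v').
  have S x y z : brsum (fun l => nf (u ++ l :: z :: v')) x y =
      brsum (fun l => nf (u ++ z :: l :: v')) x y +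
      brsum (fun l => brsum phi l z) x y.
    rewrite -brsumD; apply: eq_brsum => l; apply: IHs.
    by rewrite ew !size_cat /= ltn_add2l.
  rewrite (S b b' a) (S a b b') (S a b' b).
  have -> : brsum (fun l => brsum phi l b) a b' =
      brsum (fun l => brsum phi l a) b b' + brsum (fun l => brsum phi l b') a b.
    apply/eqP; rewrite brsum_anti eq_sym -addr_eq0 [X in X + _ == _]addrC.
    by rewrite brsum_jacobi.
  have R x y z : brsum (fun l => nf (rcons u x ++ l :: v')) y z =
      brsum (fun l => nf (u ++ x :: l :: v')) y z.
    by apply: eq_brsum => l; rewrite cat_rcons.
  by rewrite !R !addrA [LHS](ACl (1*5*4*3*6*2)).
- (* The descents a b and a' b' are separated by m. *)
  subst u' v; rewrite -!catA !cat_cons in hsw hsw' ew *.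
  have E1 : exchange_at nf (u ++ b :: a :: m) a' b' v'.
    by apply: IH' => //; rewrite -catA.
  have E2 : exchange_at nf u a b (m ++ b' :: a' :: v').
    by apply: IH'.
  rewrite /exchange_at -!catA !cat_cons in E1 E2.
  rewrite E1 E2 -!addrA; congr (_ + _).
  have S l : exchange_at nf (u ++ l :: m) a' b' v'.
    by apply: IHs; rewrite ew !size_cat /= !size_cat /=; lia.
  have S' l : exchange_at nf u a b (m ++ l :: v').
    by apply: IHs; rewrite ew !size_cat /= !size_cat /=; lia.
  under [X in _ + X = _]eq_brsum => l.
    have := S l; rewrite /exchange_at -!catA !cat_cons => ->; over.
  under [X in _ = _ + X]eq_brsum => l.
    have := S' l; rewrite /exchange_at -!catA !cat_cons => ->; over.
  rewrite !brsumD brsum_exchange addrCA; congr (_ + (_ + _)).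
    by apply: eq_brsum => l; rewrite -catA.
  by apply: eq_brsum => l'; apply: eq_brsum => l; rewrite -catA.
Qed.

End NormalForm.
End PBW.

(** * Linear maps on the universal enveloping algebra *)

Section LinearExtension.
Context {K : choiceType} {G W : zmodType} (phi : K -> G -> W).
Hypothesis phiD : forall k, {morph phi k : a b / a + b}.

Definition malg_lift (x : {malg G[K]}) : W := \sum_(k <- msupp x) phi k x@_k.

Let phi0 k : phi k 0 = 0.
Proof. by apply: (addrI (phi k 0)); rewrite -phiD !addr0. Qed.

Lemma malg_liftw (D : {fset K}) x : (msupp x `<=` D)%fset ->
  malg_lift x = \sum_(k <- D) phi k x@_k.
Proof.
move=> h; rewrite /malg_lift (big_fset_incl _ h) // => k _ /mcoeff_outdom ->.
exact: phi0.
Qed.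

Lemma malg_liftD : {morph malg_lift : x y / x + y}.
Proof.
move=> x y; pose D := (msupp x `|` msupp y)%fset.
rewrite !(@malg_liftw D) ?fsubsetUl ?fsubsetUr ?msuppD_le // -big_split /=.
by apply: eq_bigr => k _; rewrite mcoeffD phiD.
Qed.

Lemma malg_lift0 : malg_lift 0 = 0.
Proof. by rewrite /malg_lift msupp0 big_nil. Qed.

Lemma malg_liftB : {morph malg_lift : x y / x - y}.
Proof.
by move=> x y; apply/eqP; rewrite eq_sym subr_eq -malg_liftD subrK.
Qed.

Lemma malg_liftU a k : malg_lift (mkmalgU k a) = phi k a.
Proof.
by rewrite (malg_liftw msuppU_le) big_seq_fset1 mcoeffUU.
Qed.
End LinearExtension.

Lemma malg_scalerAr (R : comNzRingType) (K : monomType) (a : R)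
  (x y : {malg R[K]}) : x * (a *: y) = a *: (x * y).
Proof.
rewrite -!mul_malgC !mulrA; congr (_ * y).
rewrite !malgM_def fgmulgU fgmulUg; apply: eq_bigr => k _.
by rewrite mulrC mul1m mulm1.
Qed.

Section Generators.
Context (F : fieldType).
Implicit Types (a b c : vir_index) (u v w : seq vir_index).
Local Notation U := (Uvir F).
Local Notation T := (vir_tensor F).

(** The central letter first, then the lowering letters, L_0, and the raising
    letters: sorted words display the triangular decomposition. *)
Definition vir_le : rel vir_index := fun a b =>
  match a, b with
  | None, _ => true
  | Some _, None => false
  | Some m, Some n => m <= n
  end.

Lemma vir_le_total : total vir_le.
Proof. by case=> [m|] [n|] //=; apply: le_total. Qed.
Lemma vir_le_anti : antisymmetric vir_le.
Proof. by case=> [m|] [n|] //= /le_anti ->. Qed.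
Lemma vir_le_trans : transitive vir_le.
Proof. by case=> [m|] [n|] [p|] //=; apply: le_trans. Qed.

Definition vir_br a b : seq (F * vir_index) :=
  match a, b with
  | Some m, Some n =>
      [:: ((m - n)%:~R, Some (m + n));
          (if m + n == 0 then (m ^+ 3 - m)%:~R / 12 else 0, None)]
  | _, _ => [::]
  end.

Section BracketAxioms.
Context (W : lmodType F) (phi : vir_index -> W).
Local Notation brs := (brsum vir_br).

Lemma brsumNl a : brs phi None a = 0. Proof. by rewrite /brsum big_nil. Qed.
Lemma brsumNr a : brs phi a None = 0.
Proof. by case: a => [a|]; rewrite /brsum big_nil. Qed.

Definition cocycle (m n : int) : F :=
  if m + n == 0 then (m ^+ 3 - m)%:~R / 12 else 0.

Lemma brsumE (m n : int) : brs phi (Some m) (Some n) =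
  (m - n)%:~R *: phi (Some (m + n)) + cocycle m n *: phi None.
Proof. by rewrite /brsum !big_cons big_nil addr0. Qed.
End BracketAxioms.

Lemma cocycleC m n : cocycle m n = - cocycle n m.
Proof.
rewrite /cocycle [n + m]addrC; case: eqP => [h|]; last by rewrite oppr0.
have -> : m = - n by apply/eqP; rewrite -addr_eq0 h.
by rewrite -mulNr -rmorphN; congr (_%:~R / _); ring.
Qed.

Lemma cocycle_jacobi (a b c : int) :
  (a - b)%:~R * cocycle (a + b) c + (b - c)%:~R * cocycle (b + c) a
  + (c - a)%:~R * cocycle (c + a) b = 0.
Proof.
have e1 : b + c + a = a + b + c by ring.
have e2 : c + a + b = a + b + c by ring.
rewrite /cocycle e1 e2; case: eqP => [h|_]; last by rewrite !mulr0 !addr0.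
have -> : c = - (a + b) by apply/eqP; rewrite -addr_eq0 addrC h.
rewrite !mulrA -!mulrDl -!intrM -!intrD [X in X%:~R](_ : _ = 0) ?mul0r //.
ring.
Qed.

Lemma vir_br_refl (W : lmodType F) (phi : vir_index -> W) a :
  brsum vir_br phi a a = 0.
Proof.
case: a => [m|]; last exact: brsumNl.
rewrite brsumE subrr scale0r add0r /cocycle; case: eqP => [h|]; last first.
  by rewrite scale0r.
have -> : m = 0 by lia.
by rewrite expr0n subrr mul0r scale0r.
Qed.

Lemma vir_br_anti (W : lmodType F) (phi : vir_index -> W) a b :
  brsum vir_br phi a b = - brsum vir_br phi b a.
Proof.
case: a b => [m|] [n|]; rewrite ?brsumNl ?brsumNr ?oppr0 //.
rewrite !brsumE cocycleC [n + m]addrC -opprB rmorphN !scaleNr.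
by rewrite opprD.
Qed.

Lemma vir_br_jacobi (W : lmodType F) (phi : vir_index -> W) a b c :
  brsum vir_br (fun l => brsum vir_br phi l c) a b
  + brsum vir_br (fun l => brsum vir_br phi l a) b c
  + brsum vir_br (fun l => brsum vir_br phi l b) c a = 0.
Proof.
have inner0 a' b' : brsum vir_br (fun l => brsum vir_br phi l None) a' b' = 0.
  by rewrite /brsum big1 // => p _; rewrite -/(brsum _ _ _ _) brsumNr scaler0.
case: a b c => [a|] [b|] [c|]; rewrite ?inner0 ?brsumNl ?brsumNr ?addr0 //.
rewrite !brsumE !brsumNl !scaler0 !addr0 !scalerDr !scalerA -!intrM.
have -> : b + c + a = a + b + c by ring.
have -> : c + a + b = a + b + c by ring.
rewrite [LHS](AC (2*2*2) ((1*3*5)*(2*4*6))) /= -!scalerDl cocycle_jacobi scale0r addr0.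
by rewrite -!intrD [X in X%:~R](_ : _ = 0) ?scale0r //; ring.
Qed.

Definition Ugen a : U := if a is Some n then vL F n else vC F.
Definition Uword w : U := \prod_(a <- w) Ugen a.

Lemma Uword_cat v w : Uword (v ++ w) = Uword v * Uword w.
Proof. exact: big_cat. Qed.

Lemma Uword_cons a w : Uword (a :: w) = Ugen a * Uword w.
Proof. exact: big_cons. Qed.

Lemma Uword1 a : Uword [:: a] = Ugen a.
Proof. exact: big_seq1. Qed.

Definition Tword w : T := \prod_(a <- w) vir_gen F a.

Lemma Tword_cat v w : Tword (v ++ w) = Tword v * Tword w.
Proof. exact: big_cat. Qed.

Lemma monomial_Tword (m : {fmonom vir_index}) (x : F) :
  mkmalgU m x = x *: Tword (val m).
Proof.
have -> : mkmalgU m x = x *: (mkmalgU m 1 : T).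
  by apply/malgP => k; rewrite [RHS]mcoeffZ !mcoeffU mulrnAr mulr1.
congr (_ *: _); case: m => w /=; elim: w => [|a w IH] /=.
  by rewrite /Tword big_nil -fmoneE.
rewrite /Tword big_cons -/(Tword w) -IH /vir_gen.
have -> : FMonom (a :: w) = mmul (fmu a) (FMonom w).
  by apply: val_inj; rewrite /= fmM fmU.
by rewrite [RHS]malgM_def fgmulUU mulr1.
Qed.

Lemma Tspan (x : T) : x = \sum_(m <- msupp x) x@_m *: Tword (val m).
Proof. by rewrite {1}[x]monalgE; apply: eq_bigr => m _; rewrite monomial_Tword. Qed.

Lemma pi_Tword w : \pi_U (Tword w) = Uword w.
Proof.
elim: w => [|a w IH]; first by rewrite /Tword /Uword !big_nil.
rewrite /Tword big_cons [LHS]pi_Uvir_mul -/(Tword w) IH Uword_cons.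
by case: a.
Qed.

Lemma pi_UD (x y : T) : \pi_U (x + y) = (\pi_U x : U) + \pi_U y.
Proof. exact: pi_quotmod_add. Qed.

Lemma pi_UZ (a : F) (x : T) : \pi_U (a *: x) = a *: (\pi_U x : U).
Proof. exact: pi_quotmod_scale. Qed.

(** The enveloping algebra is spanned by the words in its generators. *)
Lemma Uind (P : U -> Prop) :
  P 0 -> (forall (a : F) x y, P x -> P y -> P (a *: x + y)) ->
  (forall w, P (Uword w)) -> forall x, P x.
Proof.
move=> P0 PD Pw; elim/quotW => x; rewrite [x]Tspan.
elim: (enum_fset _) => [|m s IH].
  by rewrite big_nil -[X in \pi X](scale0r (0 : T)) pi_UZ scale0r.
rewrite big_cons pi_UD pi_UZ pi_Tword; exact: PD.
Qed.

Lemma Tind (P : T -> Prop) :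
  P 0 -> (forall (a : F) x y, P x -> P y -> P (a *: x + y)) ->
  (forall w, P (Tword w)) -> forall x, P x.
Proof.
move=> P0 PD Pw x; rewrite [x]Tspan; elim: (enum_fset _) => [|m s IH].
  by rewrite big_nil.
by rewrite big_cons; apply: PD.
Qed.

(** The lock keeps unification from comparing two unequal products by
    unfolding them down to finitely supported functions. *)
Definition Tmul : T -> T -> T := locked *%R.

Lemma TmulE (x y : T) : Tmul x y = x * y.
Proof. by rewrite /Tmul -lock. Qed.

Lemma TmulDl (x y z : T) : Tmul (x + y) z = Tmul x z + Tmul y z.
Proof. rewrite !TmulE; exact: mulrDl. Qed.

Lemma TmulDr (x y z : T) : Tmul z (x + y) = Tmul z x + Tmul z y.
Proof. rewrite !TmulE; exact: mulrDr. Qed.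

Lemma Tmul0l x : Tmul 0 x = 0. Proof. rewrite !TmulE; exact: mul0r. Qed.
Lemma Tmul0r x : Tmul x 0 = 0. Proof. rewrite !TmulE; exact: mulr0. Qed.
Lemma TmulA (x y z : T) : Tmul x (Tmul y z) = Tmul (Tmul x y) z.
Proof. rewrite !TmulE; exact: mulrA. Qed.

Lemma TmulZl (a : F) (x y : T) : Tmul (a *: x) y = a *: Tmul x y.
Proof. by rewrite !TmulE scalerAl. Qed.

Lemma TmulZr (a : F) (x y : T) : Tmul x (a *: y) = a *: Tmul x y.
Proof. rewrite !TmulE; exact: malg_scalerAr. Qed.

Lemma vir_bracketE a b (W : lmodType F) (f : T -> W) :
  (forall (k : F) x y, f (k *: x + y) = k *: f x + f y) ->
  f (vir_bracket F a b) = brsum vir_br (fun l => f (vir_gen F l)) a b.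
Proof.
move=> fP.
have f0 : f 0 = 0.
  by have /eqP := fP (-1) 0 0; rewrite scaler0 addr0 scaleN1r addNr => /eqP.
have fZ k x : f (k *: x) = k *: f x by rewrite -[k *: x]addr0 fP f0 addr0.
case: a b => [m|] [n|]; rewrite ?brsumNl ?brsumNr ?f0 //.
rewrite brsumE /= fP /cocycle; congr (_ + _).
by case: eqP; rewrite ?fZ ?scale0r ?f0.
Qed.

Lemma Ugen_comm a b :
  Ugen a * Ugen b = Ugen b * Ugen a + brsum vir_br Ugen a b.
Proof.
have -> : brsum vir_br Ugen a b = \pi_U (vir_bracket F a b).
  rewrite (@vir_bracketE a b U (fun x => \pi_U x)); last first.
    by move=> k x y; rewrite pi_UD pi_UZ.
  by apply: eq_brsum; case.
have e c : Ugen c = \pi_U (vir_gen F c) by case: c.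
rewrite !e -[_ * _]pi_Uvir_mul -[\pi_U _ * \pi_U _]pi_Uvir_mul -pi_UD.
apply/pi_UvirP; rewrite opprD addrA.
by move=> I hI; apply: hI.2; exists (a, b).
Qed.

Section UniversalProperty.
Context {W : lmodType F} (f : seq vir_index -> W).

(** The words form a basis of the tensor algebra. *)
Lemma Tlift_exists : exists L : T -> W,
  (forall (k : F) x y, L (k *: x + y) = k *: L x + L y) /\
  forall w, L (Tword w) = f w.
Proof.
pose phi (m : {fmonom vir_index}) (k : F) := k *: f (val m).
have phiD m : {morph phi m : a b / a + b}.
  by move=> a b; rewrite /phi scalerDl.
exists (malg_lift phi); split=> [k x y|w].
  rewrite malg_liftD //; congr (_ + _).
  rewrite (@malg_liftw _ _ _ _ phiD (msupp x)) ?msuppZ_le //.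
  by rewrite scaler_sumr; apply: eq_bigr => m _; rewrite mcoeffZ /phi scalerA.
rewrite -[Tword w]scale1r -(monomial_Tword (FMonom w)).
by rewrite malg_liftU // /phi scale1r.
Qed.

Hypothesis f_exch : forall u a b v, exchange_at vir_br f u a b v.

Section Lift.
Context (L : T -> W).
Hypotheses (L_lin : forall (k : F) x y, L (k *: x + y) = k *: L x + L y)
  (L_word : forall w, L (Tword w) = f w).

Let LD x y : L (x + y) = L x + L y.
Proof. by rewrite -[x]scale1r L_lin !scale1r. Qed.

Let L0 : L 0 = 0.
Proof. by apply: (addrI (L 0)); rewrite -LD !addr0. Qed.

Let L_relation a b x y : L (Tmul (Tmul x (vir_gen F a * vir_gen F b -
  vir_gen F b * vir_gen F a - vir_bracket F a b)) y) = 0.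
Proof.
move: x y; apply: Tind => [y|k x1 x2 h1 h2 y|u].
- by rewrite !Tmul0l L0.
- by rewrite !(TmulDl, TmulZl) L_lin h1 h2 scaler0 addr0.
apply: Tind => [|k x1 x2 h1 h2|v].
- by rewrite Tmul0r L0.
- by rewrite TmulDr TmulZr L_lin h1 h2 scaler0 addr0.
pose g x := L (Tmul (Tmul (Tword u) x) (Tword v)).
have gP (k : F) x1 x2 : g (k *: x1 + x2) = k *: g x1 + g x2.
  by rewrite /g !(TmulDl, TmulZl, TmulDr, TmulZr) L_lin.
have gB x1 x2 : g (x1 - x2) = g x1 - g x2.
  by rewrite -[- x2]scaleN1r addrC gP scaleN1r addrC.
have gw w : g (Tword w) = f (u ++ w ++ v).
  by rewrite /g !TmulE -Tword_cat -Tword_cat -catA L_word.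
have g1 c : g (vir_gen F c) = f (u ++ c :: v).
  by rewrite -(gw [:: c]) /Tword big_seq1.
have g2 c d : g (vir_gen F c * vir_gen F d) = f (u ++ c :: d :: v).
  by rewrite -(gw [:: c; d]) /Tword big_cons big_seq1.
apply: (etrans (gB _ _)).
apply: (etrans (congr1 (fun z => z - _) (gB _ _))); rewrite (vir_bracketE a b gP).
have -> : brsum vir_br (fun l => g (vir_gen F l)) a b =
    brsum vir_br (fun l => f (u ++ l :: v)) a b.
  by apply: eq_brsum => l; rewrite g1.
apply/eqP; rewrite subr_eq0 subr_eq addrC; apply/eqP.
by apply: (etrans (g2 a b)); rewrite f_exch; congr (_ + _); apply: esym (g2 b a).
Qed.

Lemma lift_vanishes x : vir_ideal x -> L x = 0.
Proof.
move=> hx; suff: forall a b : T, L (Tmul (Tmul a x) b) = 0.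
  by move=> /(_ 1 1); rewrite !TmulE mul1r mulr1.
apply: (hx [set x : T | forall a b : T, L (Tmul (Tmul a x) b) = 0]); split.
  split=> [a b|y z /= hy hz a b|a y b /= hy c d].
  - by rewrite Tmul0r Tmul0l L0.
  - by rewrite TmulDr TmulDl LD hy hz addr0.
  - by rewrite -!TmulE !TmulA -TmulA hy.
by move=> _ [[a b] _ <-] /= x' y'; apply: L_relation.
Qed.

End Lift.

(** The universal property used throughout: a function on words which respects
    the commutation relations is a linear map on the enveloping algebra. *)
Lemma Uvir_lift : exists Phi : {linear U -> W}, forall w, Phi (Uword w) = f w.
Proof.
have [L [L_lin L_word]] := Tlift_exists.
have Lpi x y : \pi_U x = \pi_U y -> L x = L y.
  move/pi_UvirP/(lift_vanishes L_lin L_word).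
  rewrite -[- y]scaleN1r addrC L_lin scaleN1r => h.
  by apply/eqP; rewrite -subr_eq0 addrC h.
pose Phi (z : U) : W := L (repr z).
have PhiE x : Phi (\pi_U x) = L x by apply: Lpi; rewrite reprK.
have lin : linear Phi.
  move=> k; elim/quotW => x; elim/quotW => y.
  by rewrite -pi_UZ -pi_UD !PhiE L_lin.
pose M := GRing.isLinear.Build F U W _ Phi lin.
exists (HB.pack_for {linear U -> W} Phi M) => w /=.
by rewrite -pi_Tword PhiE L_word.
Qed.
End UniversalProperty.

Lemma Uword_exchange u a b v : exchange_at vir_br Uword u a b v.
Proof.
rewrite /exchange_at !Uword_cat !Uword_cons !mulrA -[_ * Ugen a * Ugen b]mulrA.
rewrite Ugen_comm mulrDr !mulrDl -!mulrA; congr (_ + _).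
rewrite /brsum mulr_suml mulr_sumr; apply: eq_bigr => p _.
by rewrite Uword_cat Uword_cons -scalerAl -scalerAr.
Qed.

End Generators.

(** * The Harish-Chandra projection *)

Section Bipoly.
Context (F : fieldType).

(** F[x][y] as a vector space over F, under a name of its own since
    {poly {poly F}} is a module over F[x]; x stands for the central element and
    y for L_0. *)
Definition bipoly : Type := {poly {poly F}}.
HB.instance Definition _ := GRing.ComNzRing.on bipoly.

Definition bipoly_scale (a : F) (p : bipoly) : bipoly := a%:P%:P * p.

Fact bipoly_scaleA a b p :
  bipoly_scale a (bipoly_scale b p) = bipoly_scale (a * b) p.
Proof. by rewrite /bipoly_scale mulrA -!polyCM. Qed.
Fact bipoly_scale1 : left_id 1 bipoly_scale.
Proof. by move=> p; rewrite /bipoly_scale mul1r. Qed.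
Fact bipoly_scaleDr : right_distributive bipoly_scale +%R.
Proof. by move=> a p q; rewrite /bipoly_scale mulrDr. Qed.
Fact bipoly_scaleDl p : {morph bipoly_scale^~ p : a b / a + b}.
Proof. by move=> a b; rewrite /bipoly_scale !polyCD mulrDl. Qed.

HB.instance Definition _ := GRing.Zmodule_isLmodule.Build F bipoly
  bipoly_scaleA bipoly_scale1 bipoly_scaleDr bipoly_scaleDl.

Lemma bipoly_scaleE (a : F) (p : bipoly) : a *: p = a%:P%:P * p.
Proof. by []. Qed.

Lemma bipoly_mulZ (a : F) (p q : bipoly) : p * (a *: q) = a *: (p * q).
Proof. by rewrite !bipoly_scaleE mulrCA. Qed.

Definition bx : bipoly := ('X : {poly F})%:P.
Definition bY : bipoly := 'X.

End Bipoly.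

Section Projection.
Context (F : fieldType).
Implicit Types (a b l : vir_index) (t u v w : seq vir_index).
Local Notation U := (Uvir F).
Local Notation W := (bipoly F).
Local Notation brs := (brsum (@vir_br F)).

Definition is_pos a : bool := if a is Some n then 0 < n else false.
Definition is_neg a : bool := if a is Some n then n < 0 else false.
Definition weight a : int := if a is Some n then n else 0.
Definition wsum w : int := \sum_(a <- w) weight a.

Lemma wsum_cons a w : wsum (a :: w) = weight a + wsum w.
Proof. exact: big_cons. Qed.
Lemma wsum_cat v w : wsum (v ++ w) = wsum v + wsum w.
Proof. exact: big_cat. Qed.
Lemma wsum_nil : wsum [::] = 0. Proof. exact: big_nil. Qed.

(** For a sorted word, the coefficient of the lowering word t in the image of
    the highest weight vector of the universal Verma module over F[x, y]. *)
Definition sorted_coord t w : W :=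
  if all (predC is_pos) w && (filter is_neg w == t)
  then bx F ^+ count_mem None w * bY F ^+ count_mem (Some 0) w else 0.

Lemma sorted_coord_cons0 t w :
  sorted_coord t (Some 0 :: w) = bY F * sorted_coord t w.
Proof.
rewrite /sorted_coord [all _ (_ :: _)]/= [filter _ (_ :: _)]/=.
case: ifP; rewrite ?mulr0 // => _.
by rewrite [count_mem None _]/= [count_mem (Some _) _]/= mulrCA -exprS.
Qed.

Lemma brsum_eq0 (V : lmodType F) (phi : vir_index -> V) a b :
  (forall m n : int, a = Some m -> b = Some n ->
     phi (Some (m + n)) = 0 /\ (m + n = 0 -> phi None = 0)) ->
  brs phi a b = 0.
Proof.
case: a b => [m|] [n|] h; rewrite ?brsumNl ?brsumNr //.
have [h1 h2] := h m n erefl erefl; rewrite brsumE h1 scaler0 add0r /cocycle.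
by case: eqP => [/h2 ->|_]; rewrite ?scaler0 ?scale0r.
Qed.

Lemma brsum_mul (p : W) (phi : vir_index -> W) a b :
  brs (fun l => p * phi l) a b = p * brs phi a b.
Proof.
by rewrite /brsum mulr_sumr; apply: eq_bigr => q _; rewrite bipoly_mulZ.
Qed.

Section Coordinate.
Context (t : seq vir_index).

(** [sorted_coord] extended to all words by straightening. *)
Definition wcoord : seq vir_index -> W := nf vir_le (@vir_br F) (sorted_coord t).
Local Notation N := wcoord.

Lemma wcoord_exchange u a b v : exchange_at (@vir_br F) N u a b v.
Proof.
apply: nf_exchange; [exact: vir_le_total|exact: vir_le_anti|exact: vir_le_trans
  |exact: vir_br_refl|exact: vir_br_anti|exact: vir_br_jacobi].
Qed.

Lemma wcoord_sorted w : sorted vir_le w -> N w = sorted_coord t w.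
Proof. by apply: nf_sorted. Qed.

Local Notation word_ind := (word_ind vir_le_total).

Lemma wcoord_weight w : wsum w <> wsum t -> N w = 0.
Proof.
elim/word_ind: w => [w hs _|u a b v hab IHs IH] ht.
  rewrite wcoord_sorted // /sorted_coord; case: ifP => // /andP[h /eqP ew].
  case: ht; rewrite -ew; elim: w h {hs ew} => //= a w IH /andP[ha /IH e].
  rewrite wsum_cons e; case: ifP => hn; first by rewrite wsum_cons.
  rewrite [weight a](_ : _ = 0) ?add0r //.
  case: a ha hn => [n|] //=; rewrite -leNgt => h1 /negbT; rewrite -leNgt => h2.
  by apply: le_anti; rewrite h1.
rewrite wcoord_exchange IH; last first.
  by move=> e; apply: ht; rewrite -e !wsum_cat !wsum_cons (addrCA (weight a)).
rewrite add0r; apply: brsum_eq0 => m n ea eb; rewrite ea eb in ht IHs.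
have hsz l : (size (u ++ l :: v) < size (u ++ [:: Some m, Some n & v]))%N.
  by rewrite !size_cat /= ltn_add2l.
split=> [|e]; apply: IHs => // e'; apply: ht; rewrite -e';
  rewrite !wsum_cat !wsum_cons /=; first by rewrite (addrA m).
by rewrite (addrA m) e.
Qed.

(** Straightening a word that ends with a raising letter only produces such
    words: exchanging that letter or bracketing it with a larger one leaves a
    raising letter at the end. *)
Lemma wcoord_last_pos w : is_pos (last None w) -> N w = 0.
Proof.
elim/word_ind: w => [w hs _|u a b v hab IHs IH] hl.
  rewrite wcoord_sorted // /sorted_coord; case: ifP => // /andP[/allP h _].
  case/lastP: w h hl {hs} => // w a h; rewrite last_rcons => ha.
  by have := h a; rewrite mem_rcons mem_head /= ha => /(_ isT).
have hsz l : (size (u ++ l :: v) < size (u ++ [:: a, b & v]))%N.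
  by rewrite !size_cat /= ltn_add2l.
rewrite !last_cat /= in IH IHs hl *.
have hv a' b' : v <> [::] -> last a' v = last b' v by case: (v).
have [ev|/eqP nv] := eqVneq v [::]; last first.
  rewrite wcoord_exchange IH ?add0r ?(hv _ b) //.
  by apply: brsum_eq0 => m n _ _; rewrite !IHs // last_cat /= (hv _ b).
clear hv; rewrite {v}ev /= in IH IHs hl hsz *.
case: a b hab hl IH IHs hsz => [m|] [n|] //= hmn hn IH IHs hsz.
have hm : 0 < m by rewrite -ltNge in hmn; apply: lt_trans hmn.
rewrite wcoord_exchange IH //= add0r; apply: brsum_eq0 => _ _ [<-] [<-].
split=> [|e]; last by lia.
by apply: IHs; rewrite ?last_cat //= addr_gt0.
Qed.

Lemma wcoord_consN w : N (None :: w) = bx F * N w.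
Proof.
elim/word_ind: w => [w hs _|u a b v hab IHs IH].
  have hs' : sorted vir_le (None :: w) by case: (w) hs.
  rewrite !wcoord_sorted // /sorted_coord /= add1n eqE /=.
  by case: ifP; rewrite ?mulr0 // exprS mulrA.
rewrite wcoord_exchange mulrDr -brsum_mul -IH.
rewrite -cat_cons wcoord_exchange; congr (_ + _); apply: eq_brsum => l.
by apply: IHs; rewrite !size_cat /= ltn_add2l.
Qed.

Lemma wcoord_midN u v : N (u ++ None :: v) = bx F * N (u ++ v).
Proof.
elim/last_ind: u v => [|u a IH] v; first exact: wcoord_consN.
by rewrite !cat_rcons wcoord_exchange brsumNr addr0 IH.
Qed.

Lemma wcoord_rcons0 w : N (rcons w (Some 0)) = bY F * N w.
Proof.
elim/word_ind: w => [w hs _|u a b v hab IHs IH]; last first.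
  rewrite wcoord_exchange mulrDr -brsum_mul -IH.
  rewrite !rcons_cat !rcons_cons wcoord_exchange; congr (_ + _).
  apply: eq_brsum => l; rewrite -rcons_cons -rcons_cat.
  by apply: IHs; rewrite !size_cat /= ltn_add2l.
have [hl|hl] := boolP (is_pos (last None w)).
  rewrite (wcoord_last_pos hl) mulr0.
  case/lastP: w hl hs => // w a; rewrite last_rcons; case: a => [n|] //= hn _.
  rewrite -cats1 cat_rcons wcoord_exchange wcoord_last_pos ?last_cat // add0r.
  apply: brsum_eq0 => _ _ [<-] [<-]; rewrite addr0; split=> [|e]; last by lia.
  by apply: wcoord_last_pos; rewrite last_cat.
have hs' : sorted vir_le (rcons w (Some 0)).
  case: w hs hl => //= a w hs hl; rewrite rcons_path hs /=.
  by case: (last a w) hl => //= n; rewrite -leNgt.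
rewrite !wcoord_sorted // /sorted_coord all_rcons /= -cats1 filter_cat /= cats0.
case: ifP; rewrite ?mulr0 // !count_cat /= !addn0 addn1 exprS => _.
by rewrite mulrCA.
Qed.

End Coordinate.

Local Notation N0 := (wcoord [::]).
Local Notation word_ind := (word_ind vir_le_total).

(** The mirror statement holds only for the coefficient of the empty word: what
    is produced contains a lowering letter. *)
Lemma wcoord_head_neg w : is_neg (head None w) -> N0 w = 0.
Proof.
elim/word_ind: w => [w hs _|[|x u] a b v hab IHs IH] hl.
- rewrite wcoord_sorted // /sorted_coord.
  by case: w hl {hs} => //= a w ->; rewrite andbF.
- rewrite /= in IH IHs hl *.
  case: a b hab hl IH IHs => [m|] [n|] //= hmn hm IH IHs.
    have hn : n < 0 by rewrite -ltNge in hmn; apply: lt_trans hm.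
    rewrite (wcoord_exchange _ [::]) IH // add0r; apply: brsum_eq0 => _ _ [<-] [<-].
    split=> [|e]; last by lia.
    by apply: IHs => //=; lia.
  rewrite (wcoord_exchange _ [::]) brsumNr addr0 /= wcoord_consN IHs ?mulr0 //.
- rewrite wcoord_exchange IH // add0r; apply: brsum_eq0 => m n _ _.
  by rewrite !IHs //= !size_cat /=; lia.
Qed.

Lemma wcoord_cons0 w : N0 (Some 0 :: w) = bY F * N0 w.
Proof.
elim/word_ind: w => [w hs IHs|u a b v hab IHs IH]; last first.
  rewrite wcoord_exchange mulrDr -brsum_mul -IH.
  rewrite -cat_cons wcoord_exchange; congr (_ + _).
  by apply: eq_brsum => l; apply: IHs; rewrite !size_cat /= ltn_add2l.
case: w hs IHs => [|[n|] w] hs IHs.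
- by rewrite !wcoord_sorted // sorted_coord_cons0.
- case: (ltP n 0) => hn.
    rewrite (@wcoord_head_neg (Some n :: w)) // mulr0.
    rewrite (wcoord_exchange _ [::]) /= wcoord_head_neg // add0r.
    apply: brsum_eq0 => _ _ [<-] [<-]; rewrite add0r; split=> [|e]; last by lia.
    exact: wcoord_head_neg.
  have hs' : sorted vir_le (Some 0 :: Some n :: w) by rewrite /= hn.
  by rewrite !wcoord_sorted // sorted_coord_cons0.
- rewrite (wcoord_exchange _ [::]) brsumNr addr0 /= !wcoord_consN IHs //.
  by rewrite mulrCA.
Qed.

End Projection.

Section CoordinateFunctionals.
Context (F : fieldType).
Implicit Types (a b l : vir_index) (t u v w : seq vir_index) (x y z : Uvir F).
Local Notation U := (Uvir F).
Local Notation W := (bipoly F).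

Lemma Uword_rcons w a : Uword F (rcons w a) = Uword F w * Ugen F a.
Proof. by rewrite -cats1 Uword_cat Uword1. Qed.

Lemma Uword_nil : Uword F [::] = 1. Proof. exact: big_nil. Qed.

(** The coefficient of the lowering word t in z 1, where 1 generates the
    universal Verma module over F[x, y]. *)
Definition Ucoord t : {linear U -> W} :=
  sval (cid (Uvir_lift (@wcoord_exchange F t))).

Lemma Ucoord_word t w : Ucoord t (Uword F w) = wcoord F t w.
Proof. exact: (svalP (cid (Uvir_lift (@wcoord_exchange F t)))). Qed.

Lemma bipoly_linear_eq (p : W) (f g : U -> W) :
  (forall w, f (Uword F w) = p * g (Uword F w)) ->
  linear f -> linear g -> forall x, f x = p * g x.
Proof.
move=> e lf lg.
have f0 : f 0 = 0 by have := lf (-1) 0 0; rewrite scaler0 add0r scaleN1r addNr.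
have g0 : g 0 = 0 by have := lg (-1) 0 0; rewrite scaler0 add0r scaleN1r addNr.
apply: Uind => [|k x y hx hy|w]; first by rewrite f0 g0 mulr0.
  by rewrite lf lg hx hy mulrDr bipoly_mulZ.
exact: e.
Qed.

Lemma Ucoord_mulr_lin t z : linear (fun x => Ucoord t (x * z)).
Proof. by move=> k x y; rewrite mulrDl -scalerAl linearP. Qed.

Lemma Ucoord_mull_lin t z : linear (fun x => Ucoord t (z * x)).
Proof. by move=> k x y; rewrite mulrDr -scalerAr linearP. Qed.

Lemma Ucoord_mul_pos t (n : int) x : 0 < n -> Ucoord t (x * vL F n) = 0.
Proof.
move=> hn; rewrite -(mul0r (Ucoord t x)).
apply: (@bipoly_linear_eq 0 (fun x => Ucoord t (x * vL F n)) (Ucoord t)).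
- move=> w; rewrite mul0r -[vL F n]/(Ugen F (Some n)) -Uword_rcons Ucoord_word.
  by apply: wcoord_last_pos; rewrite last_rcons.
- exact: Ucoord_mulr_lin.
- exact: linearP.
Qed.

Lemma Ucoord_mul_zero t x : Ucoord t (x * vL F 0) = bY F * Ucoord t x.
Proof.
apply: (@bipoly_linear_eq _ (fun x => Ucoord t (x * vL F 0)) (Ucoord t)).
- move=> w; rewrite -[vL F 0]/(Ugen F (Some 0)) -Uword_rcons !Ucoord_word.
  exact: wcoord_rcons0.
- exact: Ucoord_mulr_lin.
- exact: linearP.
Qed.

Lemma Ucoord_mul_central t x : Ucoord t (x * vC F) = bx F * Ucoord t x.
Proof.
apply: (@bipoly_linear_eq _ (fun x => Ucoord t (x * vC F)) (Ucoord t)).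
- move=> w; rewrite -[vC F]/(Ugen F None) -Uword_rcons !Ucoord_word.
  by rewrite -cats1 wcoord_midN cats0.
- exact: Ucoord_mulr_lin.
- exact: linearP.
Qed.

(** The Harish-Chandra projection. *)
Definition chi : {linear U -> W} := Ucoord [::].

Lemma chi_neg_mul (n : int) x : n < 0 -> chi (vL F n * x) = 0.
Proof.
move=> hn; rewrite -(mul0r (chi x)).
apply: (@bipoly_linear_eq 0 (fun x => chi (vL F n * x)) chi).
- move=> w; rewrite mul0r -[vL F n]/(Ugen F (Some n)) -Uword_cons /chi Ucoord_word.
  exact: wcoord_head_neg.
- exact: Ucoord_mull_lin.
- exact: linearP.
Qed.

Lemma chi_zero_mul x : chi (vL F 0 * x) = bY F * chi x.
Proof.
apply: (@bipoly_linear_eq _ (fun x => chi (vL F 0 * x)) chi).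
- move=> w; rewrite -[vL F 0]/(Ugen F (Some 0)) -Uword_cons /chi !Ucoord_word.
  exact: wcoord_cons0.
- exact: Ucoord_mull_lin.
- exact: linearP.
Qed.

Lemma vC_central x : vC F * x = x * vC F.
Proof.
elim/Uind: x => [|k x y hx hy|w]; first by rewrite mulr0 mul0r.
  by rewrite mulrDr mulrDl -scalerAr -scalerAl hx hy.
elim: w => [|a w IH]; first by rewrite Uword_nil mulr1 mul1r.
rewrite Uword_cons mulrA -[vC F]/(Ugen F None) Ugen_comm brsumNl addr0.
by rewrite -!mulrA IH.
Qed.

Lemma chi_central_mul x : chi (vC F * x) = bx F * chi x.
Proof. by rewrite vC_central Ucoord_mul_central. Qed.

Lemma Ucoord_weight t w : wsum w <> wsum t -> Ucoord t (Uword F w) = 0.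
Proof. by move=> h; rewrite Ucoord_word wcoord_weight. Qed.

Lemma chi1 : chi 1 = 1.
Proof. by rewrite -Uword_nil /chi Ucoord_word wcoord_sorted // /sorted_coord /= mulr1. Qed.

Lemma zero_comm_word w :
  vL F 0 * Uword F w = Uword F w * vL F 0 - (wsum w)%:~R *: Uword F w.
Proof.
elim: w => [|a w IH].
  by rewrite Uword_nil wsum_nil scale0r subr0 mulr1 mul1r.
rewrite Uword_cons wsum_cons mulrA -[vL F 0 in LHS]/(Ugen F (Some 0)) Ugen_comm.
rewrite mulrDl -[Ugen F a * _ * _]mulrA IH mulrBr mulrA -addrA; congr (_ + _).
rewrite intrD scalerDl opprD addrC -scalerAr; congr (_ + _).
case: a => [n|] /=; last by rewrite brsumNr mul0r scale0r oppr0.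
rewrite brsumE !add0r /cocycle add0r; case: eqP => [->|_].
  by rewrite expr0n subrr mul0r !scale0r oppr0 addr0 mul0r.
by rewrite scale0r addr0 -scalerAl rmorphN scaleNr.
Qed.

Definition vir_opp a : vir_index := omap -%R a.

Lemma brsum_opp (V : lmodType F) (phi : vir_index -> V) a b :
  brsum (@vir_br F) phi (vir_opp b) (vir_opp a) =
  brsum (@vir_br F) (fun l => phi (vir_opp l)) a b.
Proof.
case: a b => [m|] [n|]; rewrite ?brsumNl ?brsumNr //=.
rewrite !brsumE /= -(opprD n m) [n + m]addrC; congr (_ *: _ + _ *: _).
  by rewrite opprK addrC.
rewrite /cocycle -(opprD n m) oppr_eq0 [n + m]addrC; case: eqP => // e.
by have -> : - n = m by apply/esym/eqP; rewrite -addr_eq0 e.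
Qed.

Fact dagger_exchange u a b v : exchange_at (@vir_br F)
  (fun w => Uword F (map vir_opp (rev w))) u a b v.
Proof.
rewrite /exchange_at !rev_cat !rev_cons -!cats1 -!catA !map_cat /=.
rewrite (Uword_exchange F) brsum_opp; congr (_ + _); apply: eq_brsum => l.
by rewrite rev_cat rev_cons -cats1 -!catA !map_cat.
Qed.

(** The antiinvolution exchanging L_n and L_{-n}, for which the Shapovalov form
    is contravariant. *)
Definition dagger : {linear U -> U} :=
  sval (cid (Uvir_lift dagger_exchange)).

Lemma dagger_word w : dagger (Uword F w) = Uword F (map vir_opp (rev w)).
Proof. exact: (svalP (cid (Uvir_lift dagger_exchange))). Qed.

Lemma daggerM x y : dagger (x * y) = dagger y * dagger x.
Proof.
elim/Uind: x => [|k x x' hx hx'|w].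
- by rewrite mul0r !linear0 mulr0.
- by rewrite mulrDl -scalerAl !linearP /= hx hx' mulrDr -scalerAr.
elim/Uind: y => [|k y y' hy hy'|w'].
- by rewrite mulr0 !linear0 mul0r.
- by rewrite mulrDr -scalerAr !linearP /= hy hy' mulrDl -scalerAl.
by rewrite -Uword_cat !dagger_word rev_cat map_cat Uword_cat.
Qed.

Lemma dagger_gen a : dagger (Ugen F a) = Ugen F (vir_opp a).
Proof. by rewrite -!Uword1 dagger_word. Qed.

Lemma dagger1 : dagger 1 = 1.
Proof. by rewrite -Uword_nil dagger_word. Qed.

(** The spanning half of the Poincare-Birkhoff-Witt theorem. *)
Lemma Uind_sorted (P : U -> Prop) :
  P 0 -> (forall (k : F) x y, P x -> P y -> P (k *: x + y)) ->
  (forall w, sorted vir_le w -> P (Uword F w)) -> forall x, P x.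
Proof.
move=> P0 PD Ps; apply: Uind => // w.
elim/(word_ind vir_le_total): w => [w hs _|u a b v hab IHs IH]; first exact: Ps.
rewrite (Uword_exchange F) addrC -[X in P (_ + X)]scale1r addrC.
apply: (PD) => //; rewrite /brsum; apply: (big_ind P) => // [x y hx hy|p _].
  by rewrite -[x]scale1r; apply: PD.
rewrite -[_ *: _]addr0; apply: (PD) => //; apply: IHs.
by rewrite !size_cat /= ltn_add2l.
Qed.

End CoordinateFunctionals.

(** * PBW monomials in the lowering generators *)

Section NegativePart.
Context (F : fieldType).
Implicit Types (a b l : vir_index) (t u v w : seq vir_index) (x y z : Uvir F).
Implicit Types (s : seq nat) (d : nat).
Local Notation U := (Uvir F).

Definition lowering_word s : seq vir_index := [seq Some (- n%:Z) | n <- s].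

Lemma prod_lowering s : \prod_(n <- s) vL F (- n%:Z) = Uword F (lowering_word s).
Proof. by rewrite /Uword big_map. Qed.

Lemma pbw_word d (p : part d) : pbw p = Uword F (lowering_word (part_seq p)).
Proof. exact: prod_lowering. Qed.

Lemma wsum_lowering s : wsum (lowering_word s) = - (sumn s)%:Z.
Proof.
elim: s => [|n s IH]; first by rewrite wsum_nil.
by rewrite /= wsum_cons IH PoszD opprD.
Qed.

Lemma sorted_lowering s : sorted vir_le (lowering_word s) = sorted geq s.
Proof.
rewrite /lowering_word sorted_map; apply: eq_sorted => m n /=.
by rewrite lerN2 lez_nat.
Qed.

Lemma all_neg_lowering s : all is_neg (lowering_word s) = all (ltn 0) s.
Proof.
by rewrite all_map; apply: eq_all => n /=; rewrite oppr_lt0 ltz_nat.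
Qed.

Lemma neg_wordP w : all is_neg w -> exists s, w = lowering_word s.
Proof.
elim: w => [|[n|] w IH] //=; first by exists [::].
by move=> /andP[hn /IH[s ->]]; exists (`|n|%N :: s); rewrite /= ltz0_abs ?opprK.
Qed.

Lemma part_of_seq d s : is_part d s -> exists p : part d, part_seq p = s.
Proof.
move=> hs; have /and3P[_ h0 /eqP hsum] := hs.
have hle n : n \in s -> (n <= d)%N.
  rewrite -hsum; elim: (s) => //= m s' IH; rewrite in_cons => /orP[/eqP ->|/IH].
    exact: leq_addr.
  by move=> h; apply: leq_trans h (leq_addl _ _).
have hsz : (size (map (@inord d) s) <= d)%N.
  rewrite size_map -hsum; elim: (s) h0 => //= m s' IH.
  rewrite in_cons negb_or eq_sym -lt0n => /andP[hm /IH h].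
  by rewrite -add1n leq_add.
have e : [seq val i | i <- Bseq hsz] = s.
  rewrite /= -map_comp -[RHS]map_id; apply/eq_in_map => n /hle h /=.
  by rewrite inordK.
have hp : is_part d [seq val i | i <- Bseq hsz] by rewrite e.
by exists (exist _ (Bseq hsz) hp).
Qed.

Lemma part_seqP d (p : part d) : is_part d (part_seq p).
Proof. exact: (valP p). Qed.

Lemma part_seq_inj d : injective (@part_seq d).
Proof. by move=> p q /(inj_map val_inj)/val_inj/val_inj. Qed.

Lemma part_pos d (p : part d) : all (ltn 0) (part_seq p).
Proof.
have /and3P[_ h _] := part_seqP p; apply/allP => n hn; rewrite /= lt0n.
by apply: contraNneq h => <-.
Qed.

Lemma Uneg_lin d (k : F) x y :
  Uneg_deg d x -> Uneg_deg d y -> Uneg_deg d (k *: x + y).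
Proof.
by move=> hx hy N hN; have [[_ h] _] := hN; apply: h; [exact: hx|exact: hy].
Qed.

Lemma Uneg0 d : Uneg_deg d (0 : U).
Proof. by move=> N [[]]. Qed.

Lemma Uneg_word d w :
  all is_neg w -> wsum w = - d%:Z -> Uneg_deg d (Uword F w).
Proof.
move=> hw; have [s e] := neg_wordP hw; move: hw; rewrite {w}e all_neg_lowering.
rewrite wsum_lowering => hs [/oppr_inj [hd]] N hN; apply: hN.2.
by exists s; [split|rewrite prod_lowering].
Qed.

Lemma Uneg_ind d (P : U -> Prop) :
  P 0 -> (forall (k : F) x y, P x -> P y -> P (k *: x + y)) ->
  (forall w, all is_neg w -> wsum w = - d%:Z -> P (Uword F w)) ->
  forall x, Uneg_deg d x -> P x.
Proof.
move=> P0 PD Pw x hx; apply: (hx P); split; first by split.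
move=> _ [s [hs hd] <-]; rewrite prod_lowering; apply: Pw.
  by rewrite all_neg_lowering.
by rewrite wsum_lowering hd.
Qed.

Definition pbw_span d : set U :=
  [set x | exists v : 'cV[F]_#|part d|, x = \sum_i v i 0 *: (pbw (enum_val i) : U)].

Lemma pbw_span0 d : pbw_span d 0.
Proof. by exists 0; rewrite big1 // => i _; rewrite mxE scale0r. Qed.

Lemma pbw_span_lin d (k : F) x y :
  pbw_span d x -> pbw_span d y -> pbw_span d (k *: x + y).
Proof.
move=> [v ->] [v' ->]; exists (k *: v + v').
rewrite scaler_sumr -big_split; apply: eq_bigr => i _ /=.
by rewrite !mxE scalerDl scalerA.
Qed.

(** Straightening a word in lowering letters keeps its degree, and never
    produces the central element, the two letters having a nonzero sum. *)
Lemma pbw_span_word d w :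
  all is_neg w -> wsum w = - d%:Z -> pbw_span d (Uword F w).
Proof.
elim/(word_ind vir_le_total): w => [w hs _|u a b v hab IHs IH] hw hd.
  have [s e] := neg_wordP hw; rewrite {w}e in hs hw hd *.
  rewrite sorted_lowering all_neg_lowering wsum_lowering in hs hw hd.
  have hp : is_part d s.
    rewrite /is_part hs; case: (oppr_inj hd) => ->; rewrite eqxx andbT /=.
    by apply/negP => /(allP hw).
  have [p ep] := part_of_seq hp; exists (delta_mx (enum_rank p) 0).
  rewrite (bigD1 (enum_rank p)) //= mxE !eqxx scale1r big1 => [|i /negbTE hi].
    by rewrite enum_rankK pbw_word ep addr0.
  by rewrite mxE hi scale0r.
rewrite (Uword_exchange F) -[Uword _ _]scale1r.
have hab' : is_neg a /\ is_neg b by move: hw; rewrite all_cat /= => /and4P[].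
have hperm : all is_neg (u ++ b :: a :: v).
  by move: hw; rewrite !all_cat /= => /and4P[-> -> -> ->].
apply: pbw_span_lin; first apply: IH => //.
  by rewrite -hd !wsum_cat !wsum_cons (addrCA (weight a)).
case: a b hab' hw hd IHs {hab IH hperm} => [m|] [n|] [] //= hm hn hw hd IHs.
rewrite brsumE /cocycle; case: eqP => [|_]; first by lia.
rewrite scale0r; apply: pbw_span_lin; last exact: pbw_span0.
apply: IHs.
- by rewrite !size_cat /= ltn_add2l.
- move: hw; rewrite !all_cat /= hm hn /= => /andP[-> ->]; rewrite andbT /=.
  by lia.
- by rewrite -hd !wsum_cat !wsum_cons /= (addrA m).
Qed.

Lemma pbw_coordP d x : Uneg_deg d x ->
  x = \sum_i pbw_coord d x i 0 *: (pbw (enum_val i) : U).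
Proof.
move=> hx; suff h : pbw_span d x.
  exact: (@xgetPex _ 0 [set v : 'cV[F]_#|part d| |
    x = \sum_i v i 0 *: (pbw (enum_val i) : U)] h).
move: hx; apply: Uneg_ind; [exact: pbw_span0|exact: pbw_span_lin|].
exact: pbw_span_word.
Qed.

(** The PBW monomials are independent, even after acting on the highest weight
    vector: they are dual to functionals that factor through the Verma
    module. *)
Lemma Ucoord_pbw d (p q : part d) :
  Ucoord F (lowering_word (part_seq p)) (pbw q : U) = (p == q)%:R.
Proof.
have hq := part_pos q; rewrite pbw_word Ucoord_word wcoord_sorted; last first.
  by rewrite sorted_lowering; have /and3P[] := part_seqP q.
have hneg : all is_neg (lowering_word (part_seq q)) by rewrite all_neg_lowering.
rewrite /sorted_coord; have -> : all (predC is_pos) (lowering_word (part_seq q)).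
  by apply: sub_all hneg => -[n|] //=; lia.
have -> : [seq a <- lowering_word (part_seq q) | is_neg a] =
    lowering_word (part_seq q) by apply/all_filterP.
have c0 a : ~~ is_neg a -> count_mem a (lowering_word (part_seq q)) = 0%N.
  move=> ha; apply/count_memPn; apply: contra ha; exact: (allP hneg).
rewrite !c0 // mulr1 /= (inj_eq (inj_map _)); last by move=> m n [/oppr_inj[]].
by rewrite eq_sym (inj_eq (@part_seq_inj d)); case: eqP.
Qed.

End NegativePart.

Lemma submod_gen_sub (A : nzRingType) (V : lmodType A) (X : set V) v :
  X v -> submod_gen X v.
Proof. by move=> hv N [_ hN]; apply: hN. Qed.

(** * The degree zero component of an induced module *)

Section Induced.
Context {F : fieldType} {V : lmodType F} (X : V -> V) (c : F).
Implicit Types (p q : bipoly F) (v w : V).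
Local Notation U := (Uvir F).
Local Notation free := {malg U[V]}.
Local Notation M := (ind X c).
Local Notation inV := (ind_in X c).
Implicit Types (x y z : U).

Lemma freeZ y k z : y *: mkmalgU k z = mkmalgU k (y * z) :> free.
Proof. by apply/malgP => k'; rewrite mcoeffZ !mcoeffU mulrnAr. Qed.

Lemma pi_indD (a b : free) : \pi_M (a + b) = (\pi_M a : M) + \pi_M b.
Proof. exact: pi_quotmod_add. Qed.

Lemma pi_indZ y (a : free) : \pi_M (y *: a) = y *: (\pi_M a : M).
Proof. exact: pi_quotmod_scale. Qed.

Lemma pi_indB (a b : free) : \pi_M (a - b) = (\pi_M a : M) - \pi_M b.
Proof. by rewrite -scaleN1r pi_indD pi_indZ scaleN1r. Qed.

Lemma pi_ind_rel (a : free) : ind_rel X c a -> \pi_M a = 0 :> M.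
Proof.
move=> ha; have -> : (0 : M) = \pi_M (0 : free).
  by rewrite -[in RHS](scale0r (0 : free)) pi_indZ scale0r.
by apply/(quotmod_eqP (ind_rel X c)); rewrite subr0; apply: submod_gen_sub.
Qed.

Lemma scale_ind_in y v : y *: inV v = \pi_M (mkmalgU v y).
Proof. by rewrite -pi_indZ freeZ mulr1. Qed.

Lemma ind_inD v w : inV (v + w) = inV v + inV w.
Proof.
have : ind_rel X c (mkmalgU (v + w) 1 - mkmalgU v 1 - mkmalgU w 1).
  by do 4 left; exists (v, w).
by move/pi_ind_rel/eqP; rewrite !pi_indB -addrA -opprD subr_eq0 => /eqP.
Qed.

Lemma ind_inZ a v : inV (a *: v) = a%:A *: inV v.
Proof.
have : ind_rel X c (mkmalgU (a *: v) 1 - mkmalgU v a%:A).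
  by do 3 left; right; exists (a, v).
by move/pi_ind_rel/eqP; rewrite pi_indB subr_eq0 -!scale_ind_in ?scale1r => /eqP.
Qed.

Lemma pos_ind_in (n : int) v : 0 < n -> vL F n *: inV v = 0.
Proof.
move=> hn; rewrite scale_ind_in; apply: pi_ind_rel.
by do 2 left; right; exists (n, v).
Qed.

Lemma zero_ind_in v : vL F 0 *: inV v = inV (X v).
Proof.
have : ind_rel X c (mkmalgU v (vL F 0) - mkmalgU (X v) 1).
  by left; right; exists v.
by move/pi_ind_rel/eqP; rewrite pi_indB subr_eq0 -!scale_ind_in ?scale1r => /eqP.
Qed.

Lemma central_ind_in v : vC F *: inV v = c%:A *: inV v.
Proof.
have : ind_rel X c (mkmalgU v (vC F) - mkmalgU v c%:A).
  by right; exists v.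
by move/pi_ind_rel/eqP; rewrite pi_indB subr_eq0 -!scale_ind_in ?scale1r => /eqP.
Qed.

Lemma ind_in0 : inV 0 = 0.
Proof. by rewrite -(scale0r (0 : V)) ind_inZ scale0r scale0r. Qed.

Lemma ind_in_sum (I : Type) (r : seq I) (P : pred I) (f : I -> V) :
  inV (\sum_(i <- r | P i) f i) = \sum_(i <- r | P i) inV (f i).
Proof. exact: (big_morph _ ind_inD ind_in0). Qed.

Lemma ind_elim (P : M -> Prop) :
  P 0 -> (forall y v m, P m -> P (y *: inV v + m)) -> forall m, P m.
Proof.
move=> P0 PD; elim/quotW => x; rewrite [x]monalgE.
elim: (enum_fset _) => [|k s IH].
  by rewrite big_nil -(scale0r (0 : free)) pi_indZ scale0r.
rewrite big_cons pi_indD -scale_ind_in; exact: PD.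
Qed.

Lemma central_ind (m : M) : vC F *: m = c%:A *: m.
Proof.
elim/ind_elim: m => [|y v m IH]; first by rewrite !scaler0.
rewrite !scalerDr IH !scalerA vC_central -scalerA central_ind_in !scalerA.
by rewrite -scalerAr mulr1 -scalerAl mul1r.
Qed.

(** The action of a polynomial in x and y on V, by c for x and by X for y. *)
Definition ev p v : V := \sum_(i < size p) (p`_i).[c] *: iter i X v.

Lemma ev_wide n p v : (size p <= n)%N ->
  ev p v = \sum_(i < n) (p`_i).[c] *: iter i X v.
Proof.
move=> h; rewrite /ev (big_ord_widen n (fun i => (p`_i).[c] *: iter i X v) h).
rewrite big_mkcond /=; apply: eq_bigr => i _; case: ltnP => // hi.
by rewrite nth_default // horner0 scale0r.
Qed.

Lemma ev_linear v : linear (ev ^~ v).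
Proof.
move=> k p q; pose n := maxn (size (k *: p + q)) (maxn (size p) (size q)).
rewrite !(@ev_wide n) ?leq_maxl ?leq_max ?leqnn ?orbT //.
rewrite scaler_sumr -big_split; apply: eq_bigr => i _ /=.
rewrite bipoly_scaleE coefD coefCM hornerD hornerM hornerC scalerDl.
by rewrite scalerA.
Qed.

Lemma ev_bx p v : ev (bx F * p) v = c *: ev p v.
Proof.
pose n := maxn (size (bx F * p)) (size p).
rewrite !(@ev_wide n) ?leq_maxl ?leq_maxr // scaler_sumr.
by apply: eq_bigr => i _; rewrite coefCM hornerM hornerX scalerA.
Qed.

Lemma ev_bY p v : ev (bY F * p) v = ev p (X v).
Proof.
have h : (size (bY F * p)%R <= (size p).+1)%N.
  by apply: leq_trans (size_polyMleq _ _) _; rewrite size_polyX.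
rewrite (ev_wide v h) big_ord_recl /= coefXM eqxx horner0 scale0r add0r.
apply: eq_bigr => i _; rewrite /= coefXM /=.
by rewrite -iterS iterSr.
Qed.

Lemma ev1 v : ev 1 v = v.
Proof.
by rewrite /ev size_polyC oner_eq0 big_ord1 coefC eqxx hornerC scale1r.
Qed.

Lemma ev0 v : ev 0 v = 0.
Proof. by rewrite /ev size_poly0 big_ord0. Qed.

Lemma evZ k p v : ev (k *: p) v = k *: ev p v.
Proof. by rewrite -[k *: p]addr0 ev_linear ev0 addr0. Qed.

Hypothesis X_lin : linear X.

Lemma iterX_lin i : linear (iter i X).
Proof. by elim: i => [|i IH] k v w //=; rewrite IH X_lin. Qed.

Lemma ev_linearr p : linear (ev p).
Proof.
move=> k v w; rewrite /ev scaler_sumr -big_split; apply: eq_bigr => i _ /=.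
by rewrite iterX_lin scalerDr !scalerA mulrC.
Qed.

Lemma ev0r p : ev p 0 = 0.
Proof. by have := ev_linearr p (-1) 0 0; rewrite scaler0 add0r scaleN1r addNr. Qed.

Lemma evZr p k v : ev p (k *: v) = k *: ev p v.
Proof. by rewrite -[k *: v]addr0 ev_linearr ev0r addr0. Qed.

Lemma ev_X p v : ev p (X v) = X (ev p v).
Proof.
have X0 : X 0 = 0 by have := X_lin (-1) 0 0; rewrite scaler0 add0r scaleN1r addNr.
rewrite /ev; have XD : {morph X : v w / v + w}.
  by move=> v1 v2; rewrite -[v1 in LHS]scale1r X_lin scale1r.
rewrite (big_morph _ XD X0); apply: eq_bigr => i _.
by rewrite -iterSr iterS -[_ *: iter _ _ _]addr0 X_lin X0 addr0.
Qed.

(** On the free module, the projection to degree zero: z u is sent to chi z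
    acting on u. It is well defined on the quotient, as chi turns right
    multiplication by L_n (n > 0), L_0 and the central element into
    multiplication by 0, y and x. *)
Definition free_vac (a : free) : V := malg_lift (fun v y => ev (chi F y) v) a.

Let free_vacD : {morph free_vac : a b / a + b}.
Proof.
apply: malg_liftD => v y z; rewrite linearD.
by rewrite -[chi F y]scale1r ev_linear !scale1r.
Qed.

Let free_vacU v y : free_vac (mkmalgU v y) = ev (chi F y) v.
Proof.
apply: malg_liftU => {}v {}y z; rewrite linearD.
by rewrite -[chi F y]scale1r ev_linear !scale1r.
Qed.

Let free_vacB : {morph free_vac : a b / a - b}.
Proof.
by move=> a b; apply/eqP; rewrite eq_sym subr_eq -free_vacD subrK.
Qed.

Let free_vac_rel (a : free) : submod_gen (ind_rel X c) a -> free_vac a = 0.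
Proof.
move=> ha; suff: forall z, free_vac (z *: a) = 0.
  by move=> /(_ 1); rewrite scale1r.
apply: (ha [set a | forall z, free_vac (z *: a) = 0]); split.
  split=> [z|y m1 m2 /= h1 h2 z]; first by rewrite scaler0; apply: malg_lift0.
  by rewrite scalerDr free_vacD scalerA h1 h2 addr0.
have chiZ y (k : F) v : ev (chi F (y * k%:A)) v = k *: ev (chi F y) v.
  by rewrite -scalerAr mulr1 linearZ evZ.
move=> b [[[[]|]|]|] /=.
- move=> [[v w] _ <-] z /=; rewrite !scalerBr !freeZ !free_vacB !free_vacU mulr1.
  by rewrite -[v in v + w]scale1r ev_linearr !scale1r addrAC addrK subrr.
- move=> [[k v] _ <-] z /=; rewrite !scalerBr !freeZ !free_vacB !free_vacU mulr1.
  by rewrite chiZ evZr subrr.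
- move=> [[n v] /= hn <-] z; rewrite freeZ free_vacU /chi Ucoord_mul_pos //.
  exact: ev0.
- move=> [v _ <-] z; rewrite !scalerBr !freeZ !free_vacB !free_vacU mulr1.
  by rewrite /chi Ucoord_mul_zero ev_bY subrr.
- move=> [v _ <-] z; rewrite !scalerBr !freeZ !free_vacB !free_vacU chiZ.
  by rewrite /chi Ucoord_mul_central ev_bx subrr.
Qed.

Definition vac (m : M) : V := free_vac (repr m).

Let vac_pi a : vac (\pi_M a) = free_vac a.
Proof.
apply/eqP; rewrite -subr_eq0 -free_vacB; apply/eqP/free_vac_rel.
by apply/(quotmod_eqP (ind_rel X c)); rewrite reprK.
Qed.

Lemma vacD : {morph vac : m1 m2 / m1 + m2}.
Proof.
by elim/quotW=> a; elim/quotW=> b; rewrite -pi_indD !vac_pi free_vacD.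
Qed.

Lemma vac0 : vac 0 = 0.
Proof. by apply: (addrI (vac 0)); rewrite -vacD !addr0. Qed.

Lemma vac_sum (I : Type) (r : seq I) (P : pred I) (f : I -> M) :
  vac (\sum_(i <- r | P i) f i) = \sum_(i <- r | P i) vac (f i).
Proof. exact: (big_morph _ vacD vac0). Qed.

Lemma vac_in y v : vac (y *: inV v) = ev (chi F y) v.
Proof. by rewrite scale_ind_in vac_pi free_vacU. Qed.

End Induced.

Section DegreeZero.
Context {F : fieldType} {V : lmodType F} (X : V -> V) (c : F).
Hypothesis X_lin : linear X.
Implicit Types (v : V) (w : seq vir_index).
Local Notation U := (Uvir F).
Local Notation M := (ind X c).
Local Notation inV := (ind_in X c).
Implicit Types (x y z : U) (m : M).
Local Notation vac := (@vac F V X c).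
Local Notation ind_deg := (@ind_deg F V X c).

Lemma ind_deg_single d y v : Uneg_deg d y -> ind_deg d (y *: inV v).
Proof. by move=> hy; exists 1%N, (fun=> y), (fun=> v); rewrite big_ord1. Qed.

Lemma ind_deg0 d : ind_deg d 0.
Proof. by exists 0%N, (fun=> 0), (fun=> 0); rewrite big_ord0; split=> // -[]. Qed.

Lemma ind_degD d m m' : ind_deg d m -> ind_deg d m' -> ind_deg d (m + m').
Proof.
move=> [n [y [v [hy ->]]]] [n' [y' [v' [hy' ->]]]].
exists (n + n')%N, (fun i => match split i with inl j => y j | inr j => y' j end),
  (fun i => match split i with inl j => v j | inr j => v' j end).
split=> [i|]; first by case: splitP.
rewrite big_split_ord; congr (_ + _); apply: eq_bigr => i _.
  by rewrite (unsplitK (inl i)).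
by rewrite (unsplitK (inr i)).
Qed.

Lemma ind_deg_mul d d' z m : (forall y, Uneg_deg d y -> Uneg_deg d' (z * y)) ->
  ind_deg d m -> ind_deg d' (z *: m).
Proof.
move=> hz [n [y [v [hy ->]]]]; exists n, (fun i => z * y i), v.
split=> [i|]; first exact: hz.
by rewrite scaler_sumr; apply: eq_bigr => i _; rewrite scalerA.
Qed.

Lemma Uneg_scale d (a : F) y : Uneg_deg d y -> Uneg_deg d (a%:A * y).
Proof.
move=> hy; rewrite -scalerAl mul1r -[_ *: _]addr0.
by apply: Uneg_lin => //; apply: Uneg0.
Qed.

Lemma Uneg_lower d n y : (0 < n)%N -> Uneg_deg d y ->
  Uneg_deg (n + d) (vL F (- n%:Z) * y).
Proof.
move=> hn; apply: (Uneg_ind (P := fun y => Uneg_deg (n + d) (vL F (- n%:Z) * y))).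
- by rewrite mulr0; apply: Uneg0.
- by move=> k y1 y2 h1 h2; rewrite mulrDr -scalerAr; apply: Uneg_lin.
move=> w hw hd; rewrite -[vL _ _]/(Ugen F (Some (- n%:Z))) -Uword_cons.
apply: Uneg_word; first by rewrite /= hw andbT oppr_lt0 ltz_nat.
by rewrite wsum_cons hd PoszD opprD.
Qed.

(** The components of degree at least N are required to vanish, so that
    decompositions of different lengths can be added termwise. *)
Definition graded m := exists N (m_ : nat -> M),
  [/\ forall d, ind_deg d (m_ d), forall d, (N <= d)%N -> m_ d = 0 &
      m = \sum_(d < N) m_ d].

Lemma graded_wide N (m_ : nat -> M) n : (forall d, (N <= d)%N -> m_ d = 0) ->
  (N <= n)%N -> \sum_(d < N) m_ d = \sum_(d < n) m_ d.
Proof.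
move=> h hn; rewrite (big_ord_widen n m_ hn) big_mkcond /=.
by apply: eq_bigr => d _; case: ltnP => // /h.
Qed.

Lemma gradedD m m' : graded m -> graded m' -> graded (m + m').
Proof.
move=> [N [m_ [hd h0 ->]]] [N' [m_' [hd' h0' ->]]].
exists (maxn N N'), (fun d => m_ d + m_' d); split=> [d|d|].
- exact: ind_degD.
- by rewrite geq_max => /andP[/h0 -> /h0' ->]; rewrite addr0.
rewrite big_split /=; congr (_ + _); apply: graded_wide => //.
  exact: leq_maxl.
exact: leq_maxr.
Qed.

Lemma graded_deg d m : ind_deg d m -> graded m.
Proof.
move=> hm; exists d.+1, (fun e => if e == d then m else 0); split=> [e|e he|].
- by case: eqP => [->|_] //; apply: ind_deg0.
- by rewrite gtn_eqF.
by rewrite big_ord_recr /= eqxx big1 ?add0r // => i _; rewrite ltn_eqF.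
Qed.

Lemma graded0 : graded 0. Proof. exact: (graded_deg (ind_deg0 0)). Qed.

Lemma graded_sum (I : Type) (r : seq I) (P : pred I) (f : I -> M) :
  (forall i, P i -> graded (f i)) -> graded (\sum_(i <- r | P i) f i).
Proof. by move=> h; apply: big_ind => //; [exact: graded0|exact: gradedD]. Qed.

Lemma graded_mul z m :
  (forall d, exists d', forall y, Uneg_deg d y -> Uneg_deg d' (z * y)) ->
  graded m -> graded (z *: m).
Proof.
move=> hz [N [m_ [hd _ ->]]]; rewrite scaler_sumr; apply: graded_sum => d _.
by have [d' h] := hz d; apply: (@graded_deg d'); apply: ind_deg_mul h _.
Qed.

Lemma nonneg_word_ind_in w v :
  all (fun a => if a is Some n then 0 <= n else false) w ->
  exists v', Uword F w *: inV v = inV v'.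
Proof.
elim: w => [|[n|] w IH] //=; first by exists v; rewrite Uword_nil scale1r.
case/andP=> hn /IH[v' e]; rewrite Uword_cons -scalerA e /=.
move: hn; rewrite le_eqVlt => /orP[/eqP <-|hn].
  by exists (X v'); rewrite zero_ind_in.
by exists 0; rewrite pos_ind_in // ind_in0.
Qed.

(** By induction on a sorted word: raising letters and L_0 act within degree
    zero, the central element by a scalar, and lowering letters shift the
    degree. *)
Lemma graded_all m : graded m.
Proof.
elim/(@ind_elim F V X c): m => [|y v m IH]; first exact: graded0.
apply: gradedD; last exact: IH.
elim/Uind_sorted: y => [|k x y hx hy|w hw].
- by rewrite scale0r; apply: graded0.
- rewrite scalerDl; apply: gradedD; last exact: hy.
  have -> : k *: x = k%:A * x by rewrite -scalerAl mul1r.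
  rewrite -scalerA; apply: graded_mul; last exact: hx.
  by move=> d; exists d => z; apply: Uneg_scale.
elim: w hw => [|[n|] w IHw] hw.
- rewrite Uword_nil; apply: (@graded_deg 0); apply: ind_deg_single.
  by rewrite -Uword_nil; apply: Uneg_word => //; rewrite wsum_nil.
- have [hn|hn] := ltP n 0.
    rewrite Uword_cons -scalerA; apply: graded_mul; last exact/IHw/(path_sorted hw).
    move=> d; exists (`|n| + d)%N => y hy /=.
    have hn0 : (0 < `|n|)%N by rewrite absz_gt0 lt_eqF.
    have e : - `|n|%N%:Z = n by rewrite ltz0_abs // opprK.
    by have := Uneg_lower hn0 hy; rewrite e.
  have [|v' ->] := @nonneg_word_ind_in (Some n :: w) v.
    rewrite /= hn /=; apply: sub_all (order_path_min vir_le_trans hw).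
    by move=> [p|] //=; apply: le_trans.
  rewrite -[inV v']scale1r; apply: (@graded_deg 0); apply: ind_deg_single.
  by rewrite -Uword_nil; apply: Uneg_word => //; rewrite wsum_nil.
- rewrite Uword_cons -scalerA central_ind; apply: graded_mul.
    by move=> d; exists d => z; apply: Uneg_scale.
  exact/IHw/(path_sorted hw).
Qed.

Lemma chi_Uneg d y : (0 < d)%N -> Uneg_deg d y -> chi F y = 0.
Proof.
move=> hd; apply: (Uneg_ind (P := fun y => chi F y = 0)).
- exact: linear0.
- by move=> k x z hx hz; rewrite linearP hx hz scaler0 addr0.
by move=> w _ hw; apply: Ucoord_weight; rewrite hw wsum_nil; lia.
Qed.

Lemma vac_ind_deg d m : (0 < d)%N -> ind_deg d m -> vac m = 0.
Proof.
move=> hd [n [y [v [hy ->]]]]; rewrite vac_sum // big1 // => i _.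
by rewrite vac_in // (chi_Uneg hd) // ev0.
Qed.

Lemma ind_deg_zero m : ind_deg 0 m -> m = inV (vac m).
Proof.
have h1 y : Uneg_deg 0 y -> exists a : F, y = a%:A.
  apply: (Uneg_ind (P := fun y => exists a : F, y = a%:A)).
  - by exists 0; rewrite scale0r.
  - by move=> k _ _ [a ->] [b ->]; exists (k * a + b); rewrite scalerDl scalerA.
  move=> w hw hd; exists 1; have [s e] := neg_wordP hw.
  move: hw hd; rewrite e all_neg_lowering wsum_lowering.
  case: s {e} => [|n s] /=; first by rewrite Uword_nil scale1r.
  by move=> /andP[hn _]; lia.
move=> [n [y [v [hy ->]]]]; rewrite vac_sum // ind_in_sum; apply: eq_bigr => i _.
have [a ->] := h1 _ (hy i).
by rewrite vac_in // linearZ chi1 evZ ev1 ind_inZ.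
Qed.

Lemma zero_deg0P m : zero_deg0_component m <-> vac m = 0.
Proof.
split=> [[N [m_ [hd -> h0]]]|hv].
  rewrite vac_sum // big1 // => -[[|d] hdN] _ /=; first by rewrite h0 vac0.
  exact: vac_ind_deg (hd _).
have [N [m_ [hd h0 e]]] := graded_all m; exists N, m_; split=> //.
rewrite (ind_deg_zero (hd 0%N)); case: N h0 e => [|N] h0 e.
  by rewrite h0 // vac0 // ind_in0.
move: hv; rewrite e big_ord_recl vacD // vac_sum // big1 ?addr0.
  by move=> ->; rewrite ind_in0.
by move=> i _; apply: vac_ind_deg (hd _).
Qed.

(** The definition of J only asks for some decomposition with no component of
    degree zero; this makes it a condition on the projection. *)
Lemma ind_JP m : ind_J m <-> forall y, vac (y *: m) = 0.
Proof. by split=> h y; apply/zero_deg0P/h. Qed.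

End DegreeZero.

(** * The annihilator of the highest weight vector *)

Section VermaAnnihilator.
Context (F : fieldType) (c h : F).
Local Notation U := (Uvir F).
Implicit Types (x y z : U).

(** The Verma module is presented by the relations of its highest weight
    vector, so its annihilator is the left ideal that they generate. *)
Lemma hwv_annihilator (N : set U) :
  N 0 -> (forall z x y, N x -> N y -> N (z * x + y)) ->
  (forall n : int, 0 < n -> N (vL F n)) ->
  N (vL F 0 - h%:A) -> N (vC F - c%:A) ->
  forall y, y *: hwv c h = 0 -> N y.
Proof.
move=> N0 NP Npos Nzero Nc y; rewrite /hwv scale_ind_in => hy.
pose phi (v : F^o) (z : U) := (v : F) *: z.
have phiD v : {morph phi v : a b / a + b} by move=> a b; rewrite /phi scalerDr.
pose f := malg_lift phi.
have fZ z a : f (z *: a) = z * f a.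
  rewrite /f (@malg_liftw _ _ _ _ phiD (msupp a)) ?msuppZ_le // mulr_sumr.
  by apply: eq_bigr => k _; rewrite mcoeffZ /phi scalerAr.
have NM z x : N x -> N (z * x) by move=> hx; rewrite -[_ * _]addr0; apply: NP.
have fU v z : f (mkmalgU v z) = v *: z by apply: malg_liftU.
have fB a b : f (a - b) = f a - f b by apply: malg_liftB.
have NZ (v : F) x : N x -> N (v *: x).
  by move=> hx; rewrite -[x]mul1r scalerAl; apply: NM.
have : submod_gen (ind_rel (fun v : F^o => h *: v) c) (mkmalgU (1 : F^o) y).
  rewrite -[mkmalgU _ _]subr0; apply/(quotmod_eqP (ind_rel _ c)).
  by rewrite hy -[in RHS](scale0r (0 : {malg U[F^o]})) pi_indZ scale0r.
move=> /(_ [set a | N (f a)]) /=; rewrite fU scale1r; apply; split.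
  split=> [|z a b /= ha hb]; first by rewrite /= /f malg_lift0.
  by rewrite /f malg_liftD // -/f fZ; apply: NP.
move=> a [[[[]|]|]|] /=.
- by move=> [[v w] _ <-] /=; rewrite !fB !fU scalerDl addrAC addrK subrr.
- move=> [[k v] _ <-] /=; rewrite !fB !fU scalerA.
  by rewrite [v * k]mulrC subrr.
- by move=> [[n v] /= hn <-]; rewrite fU; apply/NZ/Npos.
- move=> [v _ <-]; rewrite fB !fU.
  have -> : ((h *: v : F^o) : F) *: (1 : U) = (v : F) *: (h%:A : U).
    by rewrite [RHS]scalerA [(v : F) * h]mulrC.
  have hv := NZ v _ Nzero. rewrite scalerBr in hv. exact: hv.
- move=> [v _ <-]; rewrite fB !fU.
  have hv := NZ v _ Nc. rewrite scalerBr in hv. exact: hv.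
Qed.

Lemma hwv_pos (n : int) : 0 < n -> vL F n *: hwv c h = 0.
Proof. exact: pos_ind_in. Qed.

Lemma hwv_zero : vL F 0 *: hwv c h = h%:A *: hwv c h.
Proof. by rewrite /hwv zero_ind_in ind_inZ. Qed.

Lemma hwv_central m : vC F *: (m : Verma c h) = c%:A *: m.
Proof. exact: central_ind. Qed.

Lemma Verma_cyclic (m : Verma c h) : exists y, m = y *: hwv c h.
Proof.
elim/(@ind_elim F F^o (fun v => h *: v) c): m => [|y v m [z ->]].
  by exists 0; rewrite scale0r.
exists (y * ((v : F)%:A : U) + z); rewrite scalerDl -scalerA /hwv.
have := ind_inZ (fun v : F^o => h *: v) c (v : F) (1 : F^o).
by rewrite -[_ *: (1 : F^o)]/(_ * _) mulr1 => <-.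
Qed.

End VermaAnnihilator.

(** * The Gram matrix of the Shapovalov form *)

Section Eval2.
Context (F : fieldType) (c h : F).
Implicit Types (p q : bipoly F).

Definition at2 p : F := eval2 p c h.

Lemma at2_linear (k : F) p q : at2 (k *: p + q) = k * at2 p + at2 q.
Proof.
by rewrite /at2 /eval2 bipoly_scaleE hornerD hornerM hornerC hornerD hornerM hornerC.
Qed.
Lemma at2_0 : at2 0 = 0. Proof. by rewrite /at2 /eval2 !horner0. Qed.
Lemma at2_1 : at2 1 = 1. Proof. by rewrite /at2 /eval2 !hornerC. Qed.
Lemma at2D p q : at2 (p + q) = at2 p + at2 q.
Proof. by rewrite /at2 /eval2 !hornerD. Qed.
Lemma at2M p q : at2 (p * q) = at2 p * at2 q.
Proof. by rewrite /at2 /eval2 !hornerM. Qed.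
Lemma at2Z (k : F) p : at2 (k *: p) = k * at2 p.
Proof. by rewrite -[k *: p]addr0 at2_linear at2_0 addr0. Qed.
Lemma at2_bx : at2 (bx F) = c.
Proof. by rewrite /at2 /eval2 hornerC hornerX. Qed.
Lemma at2_bY : at2 (bY F) = h.
Proof. by rewrite /at2 /eval2 hornerX hornerC. Qed.
Lemma at2_sum (I : Type) (r : seq I) (P : pred I) (f : I -> bipoly F) :
  at2 (\sum_(i <- r | P i) f i) = \sum_(i <- r | P i) at2 (f i).
Proof. exact: (big_morph _ at2D at2_0). Qed.
End Eval2.

Section PolynomialIdentity.
Context (F : fieldType).
Hypothesis F0 : [pchar F] =i pred0.

Lemma poly_ext0 (p : {poly F}) : (forall x, p.[x] = 0) -> p = 0.
Proof.
move=> hp; apply: (@roots_geq_poly_eq0 _ p [seq i%:R | i <- iota 0 (size p)]).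
- by apply/allP => x _; apply/rootP/hp.
- rewrite map_inj_in_uniq ?iota_uniq // => i j _ _ /eqP.
  wlog hij : i j / (i <= j)%N.
    by move=> H; case: (leqP i j) => [|/ltnW] /H //; rewrite eq_sym => h /h.
  by rewrite eq_sym -subr_eq0 -natrB // ((pcharf0P F).1 F0) subn_eq0 => hji;
    apply/eqP; rewrite eqn_leq hij.
- by rewrite size_map size_iota.
Qed.

Lemma eval2_map (p : bipoly F) c h :
  eval2 p c h = (map_poly (horner_eval c) p).[h].
Proof.
have e : h = horner_eval c (h%:P) by rewrite horner_evalE hornerC.
by rewrite [in RHS]e horner_map.
Qed.

(** The Gram matrix is known through its values only; derivatives make sense
    because, over an infinite field, these determine it. *)
Lemma bipoly_ext (p q : bipoly F) :
  (forall c h, eval2 p c h = eval2 q c h) -> p = q.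
Proof.
move=> e; apply/polyP => i; apply/eqP; rewrite -subr_eq0; apply/eqP/poly_ext0 => c.
suff : map_poly (horner_eval c) p - map_poly (horner_eval c) q = 0.
  move/(congr1 (fun r : {poly F} => r`_i)); rewrite coef0 coefB !coef_map /= => h.
  by rewrite hornerD hornerN.
by apply: poly_ext0 => h; rewrite hornerD hornerN -!eval2_map e subrr.
Qed.
End PolynomialIdentity.

Section ShapovalovForm.
Context (F : fieldType).
Implicit Types (c h : F) (x y z : Uvir F).
Local Notation U := (Uvir F).
Local Notation at2 := (@at2 F).

Lemma hwv_eq0_Ucoord c h y : y *: hwv c h = 0 ->
  forall t z, at2 c h (Ucoord F t (z * y)) = 0.
Proof.
move: y; apply: (@hwv_annihilator _ _ _
  [set y | forall t z, at2 c h (Ucoord F t (z * y)) = 0]) => /=.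
- by move=> t z; rewrite mulr0 linear0 at2_0.
- move=> z0 x y hx hy t z.
  by rewrite mulrDr linearD at2D mulrA hx hy addr0.
- by move=> n hn t z; rewrite Ucoord_mul_pos // at2_0.
- move=> t z; rewrite mulrBr linearB -scalerAr mulr1 linearZ Ucoord_mul_zero.
  by rewrite -scaleN1r addrC at2_linear at2Z at2M at2_bY mulN1r addNr.
- move=> t z; rewrite mulrBr linearB -scalerAr mulr1 linearZ Ucoord_mul_central.
  by rewrite -scaleN1r addrC at2_linear at2Z at2M at2_bx mulN1r addNr.
Qed.

Lemma hwv_eq0_dagger c h y : y *: hwv c h = 0 ->
  forall z, at2 c h (chi F (dagger F y * z)) = 0.
Proof.
have dg (n : int) : dagger F (vL F n) = vL F (- n) by exact: (dagger_gen F (Some n)).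
have dc : dagger F (vC F) = vC F by exact: (dagger_gen F None).
move: y; apply: (@hwv_annihilator _ _ _
  [set y | forall z, at2 c h (chi F (dagger F y * z)) = 0]) => /=.
- by move=> z; rewrite linear0 mul0r linear0 at2_0.
- move=> z0 x y hx hy z.
  by rewrite linearD daggerM mulrDl linearD at2D -mulrA hx hy addr0.
- by move=> n hn z; rewrite dg chi_neg_mul ?oppr_lt0 // at2_0.
- move=> z; rewrite linearB dg oppr0 linearZ /= dagger1 mulrBl linearB.
  rewrite chi_zero_mul -scalerAl mul1r linearZ -scaleN1r addrC at2_linear.
  by rewrite at2Z at2M at2_bY mulN1r addNr.
- move=> z; rewrite linearB dc linearZ /= dagger1 mulrBl linearB.
  rewrite chi_central_mul -scalerAl mul1r linearZ -scaleN1r addrC at2_linear.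
  by rewrite at2Z at2M at2_bx mulN1r addNr.
Qed.

Lemma form_well_defined c h x x' y y' :
  x *: hwv c h = x' *: hwv c h -> y *: hwv c h = y' *: hwv c h ->
  at2 c h (chi F (dagger F x * y)) = at2 c h (chi F (dagger F x' * y')).
Proof.
move=> /eqP; rewrite -subr_eq0 -scalerBl => /eqP/hwv_eq0_dagger hx.
move=> /eqP; rewrite -subr_eq0 -scalerBl => /eqP/hwv_eq0_Ucoord hy.
have at2B p q : at2 c h (p - q) = at2 c h p - at2 c h q.
  by rewrite -scaleN1r addrC at2_linear mulN1r addrC.
have := hx y; rewrite linearB mulrBl linearB at2B => /eqP.
rewrite subr_eq0 => /eqP ->.
have := hy [::] (dagger F x'); rewrite mulrBr linearB at2B => /eqP.
by rewrite subr_eq0 => /eqP ->.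
Qed.

(** The Shapovalov form is (x 1, y 1) |-> chi (x^dagger y) at (c, h), which
    depends on the vectors x 1 and y 1 only. *)
Lemma form_exists c h : exists f : Verma c h -> Verma c h -> F,
  forall x y, f (x *: hwv c h) (y *: hwv c h) = at2 c h (chi F (dagger F x * y)).
Proof.
pose g (v : Verma c h) : U := sval (cid (Verma_cyclic v)).
have gE v : v = g v *: hwv c h by exact: (svalP (cid (Verma_cyclic v))).
exists (fun v w => at2 c h (chi F (dagger F (g v) * g w))) => x y.
exact: (form_well_defined (esym (gE _)) (esym (gE _))).
Qed.

(** The module is abstract here: for the concrete Verma module, unification
    would compare vectors by unfolding their construction. *)
Section ContravariantForm.
Context (c h : F) (M : lmodType U) (hw : M).
Context (f : M -> M -> F).

Definition contravariant : Prop :=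
  [/\ forall a v v' w, f (a%:A *: v + v') w = a * f v w + f v' w,
      forall a v w w', f v (a%:A *: w + w') = a * f v w + f v w',
      forall (n : int) v w, f (vL F n *: v) w = f v (vL F (- n) *: w) &
      f hw hw = 1].

Hypothesis hw_cyclic : forall m, exists y, m = y *: hw.

Lemma contravariant_of_chi :
  (forall x y, f (x *: hw) (y *: hw) = at2 c h (chi F (dagger F x * y))) ->
  contravariant.
Proof.
move=> fE.
have lin (a : F) x x' : a%:A *: (x *: hw) + x' *: hw = (a *: x + x') *: hw.
  by rewrite scalerA -scalerDl -scalerAl mul1r.
split=> [a v v' w|a v w w'|n v w|].
- have [x ->] := hw_cyclic v; have [x' ->] := hw_cyclic v'.
  have [y ->] := hw_cyclic w; rewrite lin !fE.
  by rewrite linearP mulrDl -scalerAl linearP at2_linear.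
- have [x ->] := hw_cyclic v; have [y' ->] := hw_cyclic w'.
  have [y ->] := hw_cyclic w; rewrite lin !fE.
  by rewrite mulrDr -scalerAr linearP at2_linear.
- have [x ->] := hw_cyclic v; have [y ->] := hw_cyclic w.
  rewrite !scalerA !fE daggerM -mulrA.
  by rewrite (dagger_gen F (Some n) : dagger F (vL F n) = vL F (- n)).
by rewrite -[hw]scale1r fE dagger1 mulr1 chi1 at2_1.
Qed.

Hypotheses (f_contra : contravariant)
  (hw_pos : forall n : int, 0 < n -> vL F n *: hw = 0)
  (hw_zero : vL F 0 *: hw = h%:A *: hw)
  (central_act : forall m : M, vC F *: m = c%:A *: m).

Let f0r v : f v 0 = 0.
Proof.
have [_ fr _ _] := f_contra.
by have := fr (-1) v 0 0; rewrite scaler0 addr0 mulN1r addNr.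
Qed.
Let f0l w : f 0 w = 0.
Proof.
have [fl _ _ _] := f_contra.
by have := fl (-1) 0 0 w; rewrite scaler0 addr0 mulN1r addNr.
Qed.
Let fZl a v w : f (a%:A *: v) w = a * f v w.
Proof. by have [fl _ _ _] := f_contra; rewrite -[_ *: v]addr0 fl f0l addr0. Qed.
Let fZr a v w : f v (a%:A *: w) = a * f v w.
Proof. by have [_ fr _ _] := f_contra; rewrite -[_ *: w]addr0 fr f0r addr0. Qed.

Lemma contravariant_adjoint x v w : f (x *: v) w = f v (dagger F x *: w).
Proof.
have [fl fr fc _] := f_contra; move: v w.
elim/Uind: x => [v w|k x y hx hy v w|s].
- by rewrite linear0 !scale0r f0r f0l.
- have kE z : k *: z = k%:A * z by rewrite -scalerAl mul1r.
  by rewrite linearP /= !scalerDl (kE x) (kE (dagger F x)) -!scalerA fl fr hx hy.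
elim: s => [|a s IH] v w; first by rewrite Uword_nil dagger1 !scale1r.
rewrite Uword_cons -scalerA daggerM -scalerA -IH dagger_gen.
case: a => [n|] /=; first exact: fc.
by rewrite !central_act fZl fZr.
Qed.

(** Letter by letter, both sides vanish when z starts with a lowering letter,
    by adjunction on the left-hand side, or ends with a raising one. *)
Lemma contravariant_vacuum z : f hw (z *: hw) = at2 c h (chi F z).
Proof.
have [fl fr fc f1] := f_contra.
elim/Uind_sorted: z => [|k x y hx hy|w hw'].
- by rewrite scale0r f0r linear0 at2_0.
- rewrite linearP at2_linear -hx -hy -fr; congr (f _ _).
  by rewrite scalerDl scalerA -scalerAl mul1r.
have adj (n : int) v w1 : f v (vL F n *: w1) = f (vL F (- n) *: v) w1.
  by rewrite fc opprK.
elim: w hw' => [|a w IH] hw'.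
  by rewrite Uword_nil scale1r f1 chi1 at2_1.
have {}IH := IH (path_sorted hw').
rewrite Uword_cons -scalerA; case: a hw' => [n|] hw' /=; last first.
  by rewrite central_act chi_central_mul at2M at2_bx fZr IH.
rewrite adj; case: (ltrgtP n 0) hw' => [hn hw'|hn hw'|-> hw'].
- by rewrite hw_pos ?oppr_gt0 // f0l chi_neg_mul // at2_0.
- have hpos : is_pos (last (Some n) w).
    have := order_path_min vir_le_trans hw'.
    case/lastP: (w) => [|w' b]; rewrite ?all_rcons ?last_rcons //.
    by move=> /andP[+ _]; case: b => //= m; apply: lt_le_trans.
  rewrite -adj scalerA -[vL F n]/(Ugen F (Some n)) -Uword_cons lastI Uword_rcons.
  case: (last _ _) hpos => // m hm; rewrite -scalerA hw_pos // scaler0 f0r.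
  by rewrite /chi Ucoord_mul_pos // at2_0.
- by rewrite oppr0 hw_zero fZl IH chi_zero_mul at2M at2_bY.
Qed.

Lemma contravariantE x y : f (x *: hw) (y *: hw) = at2 c h (chi F (dagger F x * y)).
Proof. by rewrite contravariant_adjoint scalerA contravariant_vacuum. Qed.

End ContravariantForm.

Lemma ShapovalovE c h x y : Shapovalov (x *: hwv c h) (y *: hwv c h) =
  at2 c h (chi F (dagger F x * y)).
Proof.
have [f fE] := form_exists c h.
have hf : is_Shapovalov f.
  exact: (contravariant_of_chi (@Verma_cyclic F c h) fE).
have hS : is_Shapovalov (@Shapovalov F c h).
  exact: (@xgetPex _ (fun _ _ => 0) (@is_Shapovalov F c h) (ex_intro _ f hf)).
exact: (contravariantE hS (@hwv_pos F c h) (@hwv_zero F c h)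
  (@hwv_central F c h)).
Qed.

Hypothesis F0 : [pchar F] =i pred0.

Lemma GramE d (i j : 'I_#|part d|) :
  @Gram F d i j = chi F (dagger F (pbw (enum_val i)) * pbw (enum_val j)).
Proof.
have hG : forall c h i j, eval2 (@Gram F d i j) c h =
    Shapovalov ((pbw (enum_val i) : U) *: hwv c h) (pbw (enum_val j) *: hwv c h).
  rewrite /Gram; apply: (@xgetPex _ 0 [set A : 'M[{poly {poly F}}]_#|part d| |
    forall c h i j, eval2 (A i j) c h = Shapovalov (pbw (enum_val i) *: hwv c h)
                                          (pbw (enum_val j) *: hwv c h)]).
  exists (\matrix_(i, j) (chi F (dagger F (pbw (enum_val i)) * pbw (enum_val j)))).
  by move=> c h i' j' /=; rewrite mxE ShapovalovE.
by apply: bipoly_ext => // c h; rewrite hG ShapovalovE.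
Qed.

End ShapovalovForm.

(** * The defining system and Taylor's formula *)

Section Taylor.
Context (F : fieldType) (c h : F).
Implicit Types (p q : bipoly F).

(** The coefficient of (y - h) ^ m in p (c, y). *)
Definition taylor (m : nat) p : F := eval2 (nderivn m p) c h.

Lemma taylor_linear m (k : F) p q : taylor m (k *: p + q) = k * taylor m p + taylor m q.
Proof.
rewrite /taylor bipoly_scaleE mul_polyC linearP /= -/(at2 c h _) -mul_polyC.
by rewrite -bipoly_scaleE at2_linear.
Qed.

Lemma taylor_0 m : taylor m 0 = 0.
Proof. by rewrite /taylor linear0 -/(at2 c h 0) at2_0. Qed.

Lemma taylorZ m (k : F) p : taylor m (k *: p) = k * taylor m p.
Proof. by rewrite -[k *: p]addr0 taylor_linear taylor_0 addr0. Qed.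

Lemma taylorD m p q : taylor m (p + q) = taylor m p + taylor m q.
Proof. by rewrite -[p]scale1r taylor_linear mul1r scale1r. Qed.

Lemma taylor_sum m (I : Type) (r : seq I) (P : pred I) (f : I -> bipoly F) :
  taylor m (\sum_(i <- r | P i) f i) = \sum_(i <- r | P i) taylor m (f i).
Proof. exact: (big_morph _ (taylorD m) (taylor_0 m)). Qed.

Lemma taylor0E p : taylor 0 p = at2 c h p.
Proof. by rewrite /taylor nderivn0. Qed.

Section Chain.
Context (V : lmodType F) (X : V -> V) (k : nat) (u : nat -> V).
Hypotheses (X_lin : linear X) (X_first : X (u 1%N) = h *: u 1%N)
  (X_next : forall j, (1 < j <= k)%N -> X (u j) = h *: u j + u j.-1).

(** Taylor's formula for p (c, X), since X - h shifts the chain u by one. *)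
Lemma ev_chain p j : (0 < j <= k)%N ->
  ev X c p (u j) = \sum_(1 <= l < j.+1) taylor (j - l) p *: u l.
Proof.
elim/poly_ind: p j => [|p q IH] j /andP[j0 jk].
  by rewrite ev0 big1 // => l _; rewrite taylor_0 scale0r.
have evq v : ev X c (q%:P : bipoly F) v = q.[c] *: v.
  by rewrite (@ev_wide _ _ _ _ 1) ?size_polyC ?leq_b1 // big_ord1 coefC.
have -> : ev X c (p * 'X + q%:P) (u j) =
    ev X c p (X (u j)) + q.[c] *: u j.
  have := ev_linear X c (u j) 1 (p * 'X : bipoly F) (q%:P : bipoly F).
  by rewrite !scale1r evq -ev_bY [bY F * p]mulrC.
have t0 : taylor 0 (p * 'X + q%:P) = h * taylor 0 p + q.[c].
  rewrite !taylor0E /at2 /eval2 !hornerE /=; by rewrite mulrC.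
have tS m : taylor m.+1 (p * 'X + q%:P) = taylor m p + h * taylor m.+1 p.
  rewrite /taylor nderivnMXaddC /eval2 !hornerE /=; by rewrite [_ * h]mulrC.
rewrite big_nat_recr //= subnn t0 scalerDl addrA; congr (_ + _).
have -> : \sum_(1 <= l < j) taylor (j - l) (p * 'X + q%:P) *: u l =
    \sum_(1 <= l < j) taylor (j.-1 - l) p *: u l +
    h *: \sum_(1 <= l < j) taylor (j - l) p *: u l.
  rewrite scaler_sumr -big_split /=; apply: eq_big_nat => l /andP[l0 lj].
  have -> : (j - l)%N = (j.-1 - l).+1 by lia.
  by rewrite tS scalerDl scalerA.
rewrite -addrA -scalerA -scalerDr.
have := IH j; rewrite j0 jk big_nat_recr //= subnn => /(_ isT) <-.
have [j1|j1] := leqP j 1.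
  have -> : j = 1%N by lia.
  by rewrite big_geq // add0r X_first evZr.
rewrite X_next ?j1 // ev_linearr // addrC; congr (_ + _).
rewrite IH; last by lia.
by rewrite prednK.
Qed.

End Chain.
End Taylor.

Section TriangularInduction.
Context (F : fieldType).
Local Notation U := (Uvir F).

(** Vanishing of z |-> degree zero component of z m, for m of degree d, is a
    property P of this kind. A sorted word which starts with a lowering letter
    contributes nothing, leading letters L_0 and c only act on the component,
    and a raising word of degree d is the adjoint of a PBW monomial. *)
Lemma triangular_ind d (P : U -> Prop) :
  P 0 -> (forall (k : F) x y, P x -> P y -> P (k *: x + y)) ->
  (forall (n : int) z, n < 0 -> P (vL F n * z)) ->
  (forall z, P z -> P (vL F 0 * z)) -> (forall z, P z -> P (vC F * z)) ->
  (forall w, all is_pos w -> wsum w <> d%:Z -> P (Uword F w)) ->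
  (forall p : part d, P (dagger F (pbw p))) ->
  forall z, P z.
Proof.
move=> P0 PD Pneg Pzero Pcent Ppos Ppart; apply: Uind_sorted => // w.
elim: w => [|a w IH] hw.
  have [d0|d0] := eqVneq d 0%N; last first.
    by apply: Ppos => //; rewrite wsum_nil => /esym/eqP; rewrite eqz_nat (negbTE d0).
  have [|p ep] := @part_of_seq d [::]; first by rewrite d0.
  by have := Ppart p; rewrite pbw_word ep dagger_word.
have {IH} := IH (path_sorted hw).
case: a hw => [n|] hw; last by rewrite Uword_cons; apply: Pcent.
rewrite Uword_cons /=; case: (ltrgtP n 0) hw => [hn _ _|hn hw _|-> _]; last 1 first.
- exact: Pzero.
- exact: Pneg.
rewrite -[vL F n]/(Ugen F (Some n)) -Uword_cons.
have hpos : all is_pos (Some n :: w).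
  rewrite /= hn; apply: sub_all (order_path_min vir_le_trans hw).
  by move=> [m|] //=; apply: lt_le_trans.
have [hd|/eqP hd] := eqVneq (wsum (Some n :: w)) d%:Z; last exact: Ppos.
move: (Some n :: w) hw hpos hd => {n hn} {}w hw hpos hd.
pose w' := map vir_opp (rev w).
have hneg : all is_neg w'.
  rewrite /w' all_map all_rev; apply: sub_all hpos => -[n|] //=.
  by rewrite oppr_lt0.
have [s es] := neg_wordP hneg.
have ws : wsum w' = - wsum w.
  rewrite /w'; elim: (w) => [|a v IHv]; first by rewrite wsum_nil oppr0.
  rewrite rev_cons map_rcons -cats1 wsum_cat IHv !wsum_cons wsum_nil addr0 opprD addrC.
  by case: a => [n|] //=; rewrite oppr0.
have hp : is_part d s.
  rewrite /is_part -sorted_lowering -es; apply/and3P; split.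
  - rewrite /w' sorted_map rev_sorted; apply: (sub_in_sorted _ hpos hw).
    by move=> [m|] [n|] //= _ _; rewrite lerN2.
  - by apply/negP; move: hneg; rewrite es all_neg_lowering => /allP h /h.
  - by move: ws; rewrite es wsum_lowering hd => /oppr_inj[->].
have [p ep] := part_of_seq hp.
have := Ppart p; rewrite pbw_word ep -es dagger_word /w' -map_rev revK -map_comp.
rewrite (@eq_map _ _ _ id) ?map_id // => -[n|] //=; by rewrite opprK.
Qed.

Lemma Ucoord_word_mul t d w x : Uneg_deg d x -> wsum w - d%:Z <> wsum t ->
  Ucoord F t (Uword F w * x) = 0.
Proof.
move=> hx hw; move: hx.
apply: (Uneg_ind (P := fun x => Ucoord F t (Uword F w * x) = 0)).
- by rewrite mulr0 linear0.
- by move=> k y z hy hz; rewrite mulrDr -scalerAr linearP hy hz scaler0 addr0.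
- by move=> v _ hv; rewrite -Uword_cat Ucoord_weight // wsum_cat hv.
Qed.

End TriangularInduction.

(** What is used of the induced module and of its projection to degree zero.
    The module is abstract in the sequel: unification would unfold the scaling
    of the concrete one, a quotient, down to finitely supported functions. *)
Record induced_module (F : fieldType) (V : lmodType F) (X : V -> V) (c : F)
    (M : lmodType (Uvir F)) (inV : V -> M) (vac : M -> V) : Prop := {
  im_inD : forall v w, inV (v + w) = inV v + inV w;
  im_inZ : forall (a : F) v, inV (a *: v) = a%:A *: inV v;
  im_pos : forall (n : int) v, 0 < n -> vL F n *: inV v = 0;
  im_zero : forall v, vL F 0 *: inV v = inV (X v);
  im_central : forall m : M, vC F *: m = c%:A *: m;
  im_elim : forall P : M -> Prop,
    P 0 -> (forall y v m, P m -> P (y *: inV v + m)) -> forall m, P m;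
  im_vacD : forall m m', vac (m + m') = vac m + vac m';
  im_vac : forall y v, vac (y *: inV v) = ev X c (chi F y) v }.

Lemma ind_induced_module (F : fieldType) (V : lmodType F) (X : V -> V) (c : F) :
  linear X -> induced_module X c (ind_in X c) (@vac F V X c).
Proof.
move=> X_lin; split.
- exact: ind_inD.
- exact: ind_inZ.
- exact: pos_ind_in.
- exact: zero_ind_in.
- exact: central_ind.
- exact: ind_elim.
- exact: vacD.
- exact: vac_in.
Qed.

Section Vacuum.
Context {F : fieldType} {V : lmodType F} (X : V -> V) (c : F).
Context {M : lmodType (Uvir F)} {inV : V -> M} {vac : M -> V}.
Hypotheses (X_lin : linear X) (hM : induced_module X c inV vac).
Implicit Types (m : M).

Let XD v w : X (v + w) = X v + X w.
Proof. by rewrite -[v in LHS]scale1r X_lin scale1r. Qed.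

Let X0 : X 0 = 0.
Proof. by apply: (addrI (X 0)); rewrite -XD !addr0. Qed.

Lemma im_vac0 : vac 0 = 0.
Proof. by apply: (addrI (vac 0)); rewrite -(im_vacD hM) !addr0. Qed.

Lemma im_vac_sum (I : Type) (r : seq I) (P : pred I) (f : I -> M) :
  vac (\sum_(i <- r | P i) f i) = \sum_(i <- r | P i) vac (f i).
Proof. exact: (big_morph _ (im_vacD hM) im_vac0). Qed.

Lemma im_vac_neg (n : int) m : n < 0 -> vac (vL F n *: m) = 0.
Proof.
move=> hn; elim/(im_elim hM): m => [|y v m IH]; first by rewrite scaler0 im_vac0.
by rewrite scalerDr (im_vacD hM) IH addr0 scalerA (im_vac hM) chi_neg_mul // ev0.
Qed.

Lemma im_vac_zero m : vac (vL F 0 *: m) = X (vac m).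
Proof.
elim/(im_elim hM): m => [|y v m IH]; first by rewrite scaler0 im_vac0.
rewrite scalerDr !(im_vacD hM) XD IH scalerA !(im_vac hM) chi_zero_mul ev_bY.
by rewrite (ev_X c X_lin).
Qed.

Lemma im_vacZ (k : F) m : vac (k%:A *: m) = k *: vac m.
Proof.
elim/(im_elim hM): m => [|y v m IH]; first by rewrite scaler0 im_vac0 scaler0.
rewrite scalerDr !(im_vacD hM) scalerDr IH scalerA !(im_vac hM).
by rewrite -scalerAl mul1r linearZ evZ.
Qed.

End Vacuum.

Section System.
Context (F : fieldType) (F0 : [pchar F] =i pred0) (c h : F) (d : nat).
Local Notation U := (Uvir F).

(** The factor m! is the one between the m-th derivative and the m-th Taylor
    coefficient. *)
Lemma dGram_row m (x : U) (p : part d) : Uneg_deg d x ->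
  (dGram d m c h *m pbw_coord d x) (enum_rank p) 0 =
  m`!%:R * taylor c h m (chi F (dagger F (pbw p) * x)).
Proof.
move=> hx; rewrite mxE [in RHS](pbw_coordP hx) mulr_sumr linear_sum taylor_sum.
rewrite mulr_sumr; apply: eq_bigr => j _; rewrite mxE GramE // enum_rankK.
have evMn (q : {poly {poly F}}) n : eval2 (q *+ n) c h = n%:R * eval2 q c h.
  by rewrite /eval2 !hornerMn mulr_natl.
by rewrite -scalerAr linearZ taylorZ /taylor nderivn_def evMn -mulrA [_ * eval2 _ _ _]mulrC.
Qed.

Lemma system_taylor n (Rd : nat -> U) :
  (forall j, (1 <= j <= n)%N -> Uneg_deg d (Rd j)) -> system d c h n Rd ->
  forall (p : part d) l, (1 <= l <= n)%N ->
  \sum_(l <= j < n.+1) taylor c h (j - l) (chi F (dagger F (pbw p) * Rd j)) = 0.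
Proof.
move=> hR hs p l /andP[l1 ln].
have /matrixP /(_ (enum_rank p) 0) := hs l (introT andP (conj l1 ln)).
rewrite summxE [RHS]mxE => e; apply: etrans e; apply: eq_big_nat => j /andP[lj jn].
rewrite mxE dGram_row; last by apply: hR; lia.
rewrite mulrA mulVf ?mul1r // ((pcharf0P F).1 F0) -lt0n; exact: fact_gt0.
Qed.
End System.

(** * The radical of the Verma module *)

(** What is used of the Verma module, which is abstract in the sequel for the
    same reason as the induced one. *)
Record verma_module (F : fieldType) (c h : F) (M : lmodType (Uvir F)) (hw : M) :
    Prop := {
  vm_zero : vL F 0 *: hw = h%:A *: hw;
  vm_central : forall m : M, vC F *: m = c%:A *: m;
  vm_annihilator : forall N : set (Uvir F),
    N 0 -> (forall z x y, N x -> N y -> N (z * x + y)) ->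
    (forall n : int, 0 < n -> N (vL F n)) ->
    N (vL F 0 - h%:A) -> N (vC F - c%:A) ->
    forall y, y *: hw = 0 -> N y;
  vm_coord : forall y, y *: hw = 0 ->
    forall t z, at2 c h (Ucoord F t (z * y)) = 0 }.

Lemma Verma_verma_module (F : fieldType) (c h : F) : verma_module c h (hwv c h).
Proof.
split.
- exact: hwv_zero.
- exact: hwv_central.
- exact: hwv_annihilator.
- exact: hwv_eq0_Ucoord.
Qed.

Lemma big_triangle (W : nmodType) n (G : nat -> nat -> W) :
  \sum_(1 <= j < n.+1) \sum_(1 <= l < j.+1) G j l =
  \sum_(1 <= l < n.+1) \sum_(l <= j < n.+1) G j l.
Proof.
elim: n => [|n IH]; first by rewrite !big_geq.
rewrite big_nat_recr //= IH [in RHS]big_nat_recr //= big_nat1.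
rewrite [X in _ + X]big_nat_recr //= addrA -big_split /=; congr (_ + _).
by apply: eq_big_nat => l /andP[_ ln]; rewrite [RHS]big_nat_recr //= ltnW.
Qed.

Section VermaRadical.
Context (F : fieldType) (c h : F) (d : nat).
Local Notation U := (Uvir F).
Context (M : lmodType U) (hw : M) (hM : verma_module c h hw) (S : U).
Implicit Types (x y z : U).
Hypothesis T_max : is_max_proper_submod (submod_gen [set S *: hw]).

Lemma gen1P m : submod_gen [set S *: hw] m -> exists a, m = (a * S) *: hw.
Proof.
move=> hm; apply: (hm [set m | exists a, m = (a * S) *: hw]); split=> /=.
  split=> [|b v w [a ->] [a' ->]]; first by exists 0; rewrite mul0r scale0r.
  by exists (b * a + a'); rewrite scalerA -scalerDl mulrDl mulrA.
by move=> _ ->; exists 1; rewrite mul1r.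
Qed.

(** The vectors y 1 such that chi (z y) vanishes at (c, h) for all z form a
    submodule, which is proper because chi 1 = 1. *)
Lemma chi_radical y : (forall z, at2 c h (chi F (z * y)) = 0) ->
  exists a, y *: hw = (a * S) *: hw.
Proof.
move=> hy; apply: gen1P; have [_ _ Tmax] := T_max.
pose N : set M := [set m | exists2 y, m = y *: hw &
  forall z, at2 c h (chi F (z * y)) = 0].
apply: (Tmax N); last by exists y.
- split; first by exists 0; [rewrite scale0r|move=> z; rewrite mulr0 linear0 at2_0].
  move=> a _ _ [x1 -> h1] [x2 -> h2]; exists (a * x1 + x2).
    by rewrite scalerA -scalerDl.
  by move=> z; rewrite mulrDr linearD at2D mulrA h1 h2 addr0.
- move=> NT; have : N hw by rewrite NT.
  move=> [x ex hx]; have : (1 - x) *: hw = 0 by rewrite scalerBl scale1r -ex subrr.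
  move=> /(vm_coord hM) /(_ [::] 1); rewrite mul1r linearB -scaleN1r addrC.
  rewrite at2_linear -/(chi F) chi1 at2_1 -[x]mul1r hx mulr0 add0r.
  by move/eqP; rewrite oner_eq0.
Qed.

Hypotheses (S_deg : Uneg_deg d S)
  (S_sing : forall n : int, 0 < n -> vL F n *: (S *: hw) = 0).

Lemma zero_comm x : Uneg_deg d x -> vL F 0 * x = x * vL F 0 + d%:R *: x.
Proof.
apply: (Uneg_ind (P := fun x => vL F 0 * x = x * vL F 0 + d%:R *: x)).
- by rewrite mulr0 mul0r scaler0 addr0.
- move=> k x1 x2 h1 h2; rewrite mulrDr mulrDl -scalerAr -scalerAl h1 h2.
  by rewrite !scalerDr addrACA !scalerA mulrC.
- by move=> w _ hw'; rewrite zero_comm_word hw' rmorphN scaleNr opprK.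
Qed.

Lemma S_zero : vL F 0 *: (S *: hw) = (h + d%:R)%:A *: (S *: hw).
Proof.
rewrite scalerA zero_comm // scalerDl -scalerA (vm_zero hM) scalerA.
rewrite -scalerAr mulr1 -scalerDl scalerA -scalerDl -scalerAl mul1r.
by [].
Qed.

(** The vector S 1 is singular, so the submodule that it generates has degrees
    at least d, and only its scalar multiples in degree d; z collects the
    terms of larger degree, which the functionals of degree d do not see. *)
Lemma singular_span y : exists (a : F) z,
  y *: (S *: hw) = (a *: S + z) *: hw /\
  forall t, wsum t = - d%:Z -> Ucoord F t z = 0.
Proof.
have aE (a : F) x : (a *: x : U) = a%:A * x by rewrite -scalerAl mul1r.
elim/Uind_sorted: y => [|k x y [a [z [e hz]]] [a' [z' [e' hz']]]|w].
- exists 0, 0; rewrite !scale0r addr0 scale0r; split=> // t _; exact: linear0.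
- exists (k * a + a'), (k *: z + z'); split=> [|t ht].
    have -> : (k *: x + y) *: (S *: hw) = k%:A *: (x *: (S *: hw)) + y *: (S *: hw).
      by rewrite scalerDl (aE k x) -scalerA.
    rewrite e e' [k%:A *: _]scalerA -scalerDl -(aE k); congr (_ *: hw).
    by rewrite scalerDr scalerDl scalerA addrACA.
  by rewrite linearP /= hz // hz' // scaler0 addr0.
have scale_case (b : F) x :
    (exists (a : F) z, x *: (S *: hw) = (a *: S + z) *: hw /\
       forall t, wsum t = - d%:Z -> Ucoord F t z = 0) ->
    exists (a : F) z, x *: (b%:A *: (S *: hw)) = (a *: S + z) *: hw /\
       forall t, wsum t = - d%:Z -> Ucoord F t z = 0.
  move=> [a [z [e hz]]]; exists (b * a), (b *: z); split=> [|t ht].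
    have -> : x *: (b%:A *: (S *: hw)) = b%:A *: (x *: (S *: hw)).
      by rewrite [LHS]scalerA -scalerAr mulr1 [RHS]scalerA -scalerAl mul1r.
    by rewrite e [LHS]scalerA -(aE b) scalerDr scalerA.
  by rewrite linearZ /= hz // scaler0.
elim/last_ind: w => [_|w a IH hs].
  exists 1, 0; rewrite Uword_nil addr0 !scale1r; split=> // t _; exact: linear0.
have hw' : sorted vir_le w.
  by apply: subseq_sorted hs; [exact: vir_le_trans|exact: subseq_rcons].
have {IH} := IH hw'.
rewrite Uword_rcons -scalerA; case: a hs => [n|] hs /= IH; last first.
  by rewrite (vm_central hM); apply: scale_case.
case: (ltrgtP n 0) hs => [hn hs|hn _|-> _].
- exists 0, (Uword F (rcons w (Some n)) * S); split.
    by rewrite scale0r add0r Uword_rcons -!scalerA.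
  move=> t ht; apply: (Ucoord_word_mul S_deg); rewrite ht.
  suff : wsum (rcons w (Some n)) < 0 by lia.
  rewrite -cats1 wsum_cat wsum_cons wsum_nil addr0 /=.
  have : wsum w <= 0.
    move: hs; rewrite (sorted_pairwise vir_le_trans) pairwise_rcons => /andP[+ _].
    elim: (w) => [|b v IHv] /=; first by rewrite wsum_nil.
    move=> /andP[hb /IHv hv]; rewrite wsum_cons.
    by case: b hb => [m|] /=; lia.
  by lia.
- by exists 0, 0; rewrite S_sing // scaler0 scale0r addr0 scale0r;
    split=> // t _; exact: linear0.
- by rewrite S_zero; apply: scale_case.
Qed.

(** The hypothesis puts x 1 in the radical, so that x 1 is a scalar multiple of
    the singular vector S 1; as U(L^-) acts freely on 1, the same holds for x
    and S. *)
Lemma radical_degree_d x : Uneg_deg d x ->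
  (forall p : part d, at2 c h (chi F (dagger F (pbw p) * x)) = 0) ->
  exists a : F, x = a *: S.
Proof.
move=> hx hp.
have [y ey] : exists y, x *: hw = (y * S) *: hw.
  apply: chi_radical; apply: (@triangular_ind F d).
  - by rewrite mul0r linear0 at2_0.
  - by move=> k y z hy hz; rewrite mulrDl -scalerAl linearP at2_linear hy hz mulr0 addr0.
  - by move=> n z hn; rewrite -mulrA chi_neg_mul // at2_0.
  - by move=> z hz; rewrite -mulrA chi_zero_mul at2M hz mulr0.
  - by move=> z hz; rewrite -mulrA chi_central_mul at2M hz mulr0.
  - move=> w _ hw'; rewrite /chi (Ucoord_word_mul hx) ?at2_0 // wsum_nil.
    by move=> /eqP; rewrite subr_eq0 => /eqP.
  - exact: hp.
have [a [z [e hz]]] := singular_span y; exists a.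
have hD : Uneg_deg d (x - a *: S).
  by rewrite addrC -scaleNr; apply: Uneg_lin.
have : (x - a *: S - z) *: hw = 0.
  by rewrite -addrA -opprD scalerBl -e ey scalerA subrr.
move=> /(vm_coord hM) hc.
apply/eqP; rewrite -subr_eq0 (pbw_coordP hD) big1 // => i _.
suff -> : pbw_coord d (x - a *: S) i 0 = 0 by rewrite scale0r.
have := hc (lowering_word (part_seq (enum_val i))) 1.
rewrite mul1r linearB hz ?subr0; last first.
  rewrite wsum_lowering; congr (- _%:Z).
  by have /and3P[_ _ /eqP] := part_seqP (enum_val i).
rewrite [in Ucoord F _ _](pbw_coordP hD) linear_sum at2_sum.
rewrite (bigD1 i) //= big1 => [|j ji].
  by rewrite linearZ at2Z Ucoord_pbw eqxx at2_1 mulr1 addr0.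
rewrite linearZ at2Z Ucoord_pbw (inj_eq enum_val_inj) eq_sym (negbTE ji).
by rewrite at2_0 mulr0.
Qed.

End VermaRadical.

(** * The radical of the induced module *)

Section Radical.
Context (F : fieldType) (c h : F) (d k : nat).
Local Notation U := (Uvir F).
Context (Mh : lmodType U) (hw : Mh) (hMh : verma_module c h hw) (S : U).
Hypothesis T_max : is_max_proper_submod (submod_gen [set S *: hw]).

Context (V : lmodType F) (X : V -> V) (X_lin : linear X) (u : nat -> V).
Hypotheses (X_first : X (u 1%N) = h *: u 1%N)
  (X_next : forall j, (1 < j <= k)%N -> X (u j) = h *: u j + u j.-1)
  (u_span : forall v, exists a : nat -> F, v = \sum_(1 <= l < k.+1) a l *: u l)
  (u_free : forall a : nat -> F, \sum_(1 <= l < k.+1) a l *: u l = 0 ->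
     forall l, (1 <= l <= k)%N -> a l = 0).

Context (M : lmodType U) (inV : V -> M) (vac : M -> V).
Hypothesis hM : induced_module X c inV vac.
Implicit Types (y : nat -> U) (z : U) (m : M).
Local Notation D := (taylor c h).

Definition comb n y : M := \sum_(1 <= l < n.+1) y l *: inV (u l).

Lemma vac_comb z n y : (n <= k)%N -> vac (z *: comb n y) =
  \sum_(1 <= l < n.+1)
    (\sum_(l <= j < n.+1) D (j - l) (chi F (z * y j))) *: u l.
Proof.
move=> nk; rewrite /comb scaler_sumr (im_vac_sum hM).
under [RHS]eq_bigr do rewrite scaler_suml.
rewrite -big_triangle; apply: eq_big_nat => j /andP[j1 jn].
rewrite scalerA (im_vac hM) (@ev_chain F c h V X k u X_lin X_first X_next) //.
by rewrite j1; lia.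
Qed.

Lemma comb_radical n y : (n <= k)%N ->
  (forall j, (1 <= j <= n)%N -> Uneg_deg d (y j)) ->
  (forall (p : part d) l, (1 <= l <= n)%N ->
     \sum_(l <= j < n.+1) D (j - l) (chi F (dagger F (pbw p) * y j)) = 0) ->
  forall z, vac (z *: comb n y) = 0.
Proof.
move=> nk yd hy.
have X0 : X 0 = 0 by have := X_lin (-1) 0 0; rewrite scaler0 add0r scaleN1r addNr.
apply: (@triangular_ind F d (fun z => vac (z *: comb n y) = 0)).
- by rewrite scale0r (im_vac0 hM).
- move=> a x z hx hz; have -> : a *: x = a%:A * x by rewrite -scalerAl mul1r.
  by rewrite scalerDl -scalerA (im_vacD hM) (im_vacZ hM) hx hz scaler0 addr0.
- by move=> i z hi; rewrite -scalerA (im_vac_neg hM).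
- by move=> z hz; rewrite -scalerA (im_vac_zero X_lin hM) hz.
- by move=> z hz; rewrite -scalerA (im_central hM) (im_vacZ hM) hz scaler0.
- move=> w _ hw'; rewrite vac_comb // big1_seq // => l /andP[_].
  rewrite mem_index_iota => /andP[l1 ln]; rewrite big1_seq ?scale0r // => j /andP[_].
  rewrite mem_index_iota => /andP[lj jn].
  rewrite /chi (Ucoord_word_mul (yd j _)) ?taylor_0 //; first by lia.
  by rewrite wsum_nil => /eqP; rewrite subr_eq0 => /eqP.
- move=> p; rewrite vac_comb // big1_seq // => l /andP[_].
  by rewrite mem_index_iota => /andP[l1 ln]; rewrite hy ?scale0r // l1.
Qed.

(** The coefficient of the last vector u_n of the chain only involves y_n. *)
Lemma comb_radical_top n y : (n < k)%N ->
  (forall z, vac (z *: comb n.+1 y) = 0) ->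
  forall z, at2 c h (chi F (z * y n.+1)) = 0.
Proof.
move=> nk hy z; have := hy z; rewrite vac_comb // => e.
pose a l := \sum_(l <= j < n.+2) D (j - l) (chi F (z * y j)).
have : \sum_(1 <= l < k.+1) a l *: u l = 0.
  rewrite (@big_cat_nat _ _ _ n.+2) //= e add0r.
  rewrite big1_seq // => l /andP[_]; rewrite mem_index_iota => /andP[nl _].
  by rewrite /a big_geq // scale0r.
move=> /u_free /(_ n.+1); rewrite ltnS nk => /(_ isT).
by rewrite /a big_nat1 subnn taylor0E.
Qed.

(** Each relation of the highest weight vector sends u_(n+1) to a combination
    of u_1, ..., u_n: L_0 - h to u_n, the others to 0. *)
Lemma hw_relations_comb n (x0 : U) : (n < k)%N -> x0 *: hw = 0 ->
  exists y, x0 *: inV (u n.+1) = comb n y.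
Proof.
move=> nk; move: x0.
have comb0 : comb n (fun=> 0) = 0.
  by rewrite /comb big1 // => l _; rewrite scale0r.
apply: (vm_annihilator hMh (N := [set x0 : U | exists y, x0 *: inV (u n.+1) = comb n y])).
- by exists (fun=> 0); rewrite scale0r comb0.
- move=> z x x' [y e] [y' e']; exists (fun l => z * y l + y' l).
  rewrite scalerDl -scalerA e e' /comb scaler_sumr -big_split /=.
  by apply: eq_bigr => l _; rewrite scalerDl scalerA.
- by move=> i hi; exists (fun=> 0); rewrite (im_pos hM) // comb0.
- have [n0|n0] := posnP n.
    exists (fun=> 0); rewrite comb0 n0 scalerBl (im_zero hM) X_first (im_inZ hM).
    by rewrite subrr.
  exists (fun l => if l == n then 1 else 0).
  rewrite scalerBl (im_zero hM) X_next; last by rewrite ltnS n0.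
  rewrite (im_inD hM) (im_inZ hM) addrAC subrr add0r /comb.
  rewrite big_nat_recr //= eqxx scale1r big1_seq ?add0r // => l /andP[_].
  by rewrite mem_index_iota => /andP[_ ln]; rewrite ltn_eqF // scale0r.
- exists (fun=> 0); rewrite comb0 scalerBl (im_central hM) subrr //.
Qed.

Context (Y : nat -> nat -> U).
Hypotheses (Y_top : forall n, (0 < n <= k)%N -> Y n n = S)
  (Y_rad : forall n, (0 < n <= k)%N -> forall z, vac (z *: comb n (Y n)) = 0).

Local Notation gens := [set comb n (Y n) | n in [set n : nat | (1 <= n <= k)%N]].

(** By induction on the length of the combination: its top coefficient is
    a S modulo the annihilator of 1, so that subtracting a times a generator
    shortens it. *)
Lemma radical_sub_gen n y : (n <= k)%N ->
  (forall z, vac (z *: comb n y) = 0) -> submod_gen gens (comb n y).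
Proof.
elim: n y => [|n IH] y nk hy.
  by rewrite /comb big_geq //; have [] := submod_gen_is_submod gens.
have [a ea] := chi_radical hMh T_max (comb_radical_top nk hy).
have [y' ey'] : exists y', (y n.+1 - a * S) *: inV (u n.+1) = comb n y'.
  by apply: hw_relations_comb => //; rewrite scalerBl ea subrr.
have hsub := submod_gen_is_submod gens.
have hg : submod_gen gens (comb n.+1 (Y n.+1)).
  by apply: submod_gen_sub; exists n.+1.
have e : comb n.+1 y = a *: comb n.+1 (Y n.+1) +
    comb n (fun l => y l + y' l - a * Y n.+1 l).
  have -> : comb n (fun l => y l + y' l - a * Y n.+1 l) =
      comb n y + comb n y' - a *: comb n (Y n.+1).
    rewrite /comb scaler_sumr -big_split -sumrB /=; apply: eq_bigr => l _.
    by rewrite scalerBl scalerDl scalerA.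
  rewrite -ey' /comb !(@big_nat_recr _ _ _ n.+1) //= Y_top //.
  rewrite scalerDr scalerA scalerBl.
  by rewrite [RHS]addrC addrA subrK -addrA subrK.
rewrite e; apply: hsub.2 => //; apply: IH; first exact: ltnW.
move=> z; have := hy z; rewrite e scalerDr (im_vacD hM) scalerA Y_rad ?add0r //.
Qed.

Lemma radical_eq_gen : [set m | forall z, vac (z *: m) = 0] = submod_gen gens.
Proof.
apply/seteqP; split=> m /=.
  have [y ->] : exists y, m = comb k y.
    elim/(im_elim hM): m => [|z v m [y ->]].
      by exists (fun=> 0); rewrite /comb big1 // => l _; rewrite scale0r.
    have [a ->] := u_span v; exists (fun l => z * (a l)%:A + y l).
    rewrite (big_morph _ (im_inD hM) (id1 := 0)); last first.
      by apply: (addrI (inV 0)); rewrite -(im_inD hM) !addr0.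
    rewrite /comb scaler_sumr -big_split /=; apply: eq_bigr => l _.
    by rewrite (im_inZ hM) scalerDl scalerA.
  exact: radical_sub_gen.
move=> hm; apply: (hm [set m | forall z, vac (z *: m) = 0]); split.
  split=> [z|a v w /= hv hw' z]; first by rewrite scaler0 (im_vac0 hM).
  by rewrite scalerDr (im_vacD hM) scalerA hv hw' addr0.
by move=> _ [n /= hn <-]; apply: Y_rad.
Qed.

End Radical.

(** * The main theorem *)

Section Zhu.
Context (F : fieldType) (h : F) (k : nat).

Lemma Zhu_X_linear : linear (@Zhu_X F h k).
Proof. by move=> a v w; rewrite /Zhu_X mulrDr -scalerAr. Qed.

Context (u : nat -> Zhu_mod h k) (u_basis : is_Jordan_basis u).

Let tu := [tuple u i.+1 | i < k].

Let tuE : [seq u j | j <- iota 1 k] = tu :> seq _.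
Proof.
rewrite /= [iota 1 k](iotaDl 1 0) -val_enum_ord -!map_comp.
by apply: eq_map => i /=; rewrite add1n.
Qed.

Let sum_tu (a : nat -> F) :
  \sum_(1 <= l < k.+1) a l *: u l = \sum_(i < k) a i.+1 *: tu`_i.
Proof.
rewrite big_add1 big_mkord; apply: eq_bigr => i _.
by rewrite -tnth_nth tnth_mktuple.
Qed.

Lemma Jordan_span (v : Zhu_mod h k) :
  exists a : nat -> F, v = \sum_(1 <= l < k.+1) a l *: u l.
Proof.
have [hb _ _] := u_basis; rewrite tuE in hb.
have /coord_span e : v \in <<tu>>%VS by rewrite (span_basis hb) memvf.
(* The tuple is indexed from 0, the Jordan basis from 1. *)
exists (fun l => if insub l.-1 is Some i then coord tu i v else 0).
rewrite sum_tu [LHS]e; apply: eq_bigr => i _ /=.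
by rewrite valK.
Qed.

Lemma Jordan_free (a : nat -> F) :
  \sum_(1 <= l < k.+1) a l *: u l = 0 -> forall l, (1 <= l <= k)%N -> a l = 0.
Proof.
have [hb _ _] := u_basis; rewrite tuE in hb; rewrite sum_tu => e [|l] //= hl.
have /freeP /(_ (fun i : 'I_k => a i.+1) e (Ordinal hl)) := basis_free hb.
by [].
Qed.

End Zhu.

Lemma pchar_complex (R : realType) : [pchar R[i]] =i pred0.
Proof. exact: pchar_num. Qed.

Lemma Rseq_last (F : fieldType) (S : Uvir F) R n : Rseq S R n n = S.
Proof. by rewrite /Rseq eqxx. Qed.

Lemma Rseq_lt (F : fieldType) (S : Uvir F) R n j :
  (j < n)%N -> Rseq S R n j = R (n - j)%N.
Proof. by move=> h; rewrite /Rseq ltn_eqF. Qed.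

Lemma comb_Rseq (F : fieldType) (V : lmodType F) (M : lmodType (Uvir F))
    (inV : V -> M) (u : nat -> V) (S : Uvir F) (R : nat -> Uvir F) n :
  (0 < n)%N ->
  S *: inV (u n) + \sum_(1 <= i < n) R i *: inV (u (n - i)%N) =
  comb u inV n (Rseq S R n).
Proof.
move=> n0; rewrite /comb big_nat_recr //= Rseq_last addrC; congr (_ + _).
rewrite big_nat_rev /=; apply: eq_big_nat => i /andP[i1 ilt].
rewrite Rseq_lt // add1n subSS.
by congr (_ *: inV (u _)); lia.
Qed.

Theorem theorem6p23 (R : realType) (r s : nat) (t c h : R[i])
  (S : Uvir R[i]) (kappa : option nat) (Rrs : nat -> Uvir R[i])
  (k : nat) (u : nat -> Zhu_mod h k)
  (r_gt0 : (0 < r)%N) (s_gt0 : (0 < s)%N) (r_neq_s : r <> s)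
  (t_pm1 : t = 1 \/ t = -1)
  (c_def : c = c_t t) (h_def : h = h_rs r s t)
  (S_def : is_S r s t S)
  (T_def : is_max_proper_submod (submod_gen [set S *: hwv c h]))
  (kappa_def : is_kappa (r * s) c h kappa)
  (Rrs_def : is_R (r * s) c h kappa S Rrs)
  (k_gt0 : (0 < k)%N) (u_def : is_Jordan_basis u)
  (k_le_kappa : le_kappa k kappa) :
  Jk c h k =
    submod_gen
      [set S *: Mk_in c (u n) + \sum_(1 <= i < n) Rrs i *: Mk_in c (u (n - i)%N)
         | n in [set n : nat | (1 <= n <= k)%N]]
  /\
  (forall i, (0 < i)%N -> le_kappa i.+1 kappa ->
   forall R', Uneg_deg (r * s) R' ->
     system (r * s) c h i.+1
       (Rseq S (fun l => if l == i then R' else Rrs l) i.+1) ->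
     exists a : R[i], R' - Rrs i = a *: S).
Proof.
have F0 := @pchar_complex R.
have [S_deg _ S_sing] := S_def; rewrite -c_def -h_def in S_sing.
have [R_deg R_sys] := Rrs_def.
have le_kappa_trans m n : (m <= n)%N -> le_kappa n kappa -> le_kappa m kappa.
  by case: (kappa) => //= p; apply: leq_trans.
have Rseq_deg R0 n j : (forall i, (0 < i < n)%N -> Uneg_deg (r * s) (R0 i)) ->
    (1 <= j <= n)%N -> Uneg_deg (r * s) (Rseq S R0 n j).
  move=> hR /andP[j1 jn]; rewrite /Rseq; case: eqP => // /eqP nj; apply: hR; lia.
have hMh := Verma_verma_module c h.
split.
  have [_ u1 un] := u_def.
  have hM := ind_induced_module c (@Zhu_X_linear _ h k).
  have gen_rad n : (0 < n <= k)%N -> forall z,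
      vac (z *: comb u (ind_in (@Zhu_X _ h k) c) n (Rseq S Rrs n)) = 0.
    move=> /andP[n0 nk].
    have hdeg j : (1 <= j <= n)%N -> Uneg_deg (r * s) (Rseq S Rrs n j).
      apply: Rseq_deg => i /andP[i0 ilt]; apply: R_deg => //.
      by apply: le_kappa_trans k_le_kappa; apply: leq_trans nk.
    apply: (comb_radical (@Zhu_X_linear _ h k) u1 un hM nk hdeg) => p l hl.
    apply: (system_taylor F0 hdeg) => //; apply: R_sys => //.
    exact: le_kappa_trans k_le_kappa.
  have := radical_eq_gen hMh T_def (@Zhu_X_linear _ h k) u1 un (Jordan_span u_def)
    (Jordan_free u_def) hM (Y := Rseq S Rrs) (fun n _ => Rseq_last S Rrs n) gen_rad.
  have -> : [set m | forall z, vac (z *: m) = 0] = Jk c h k.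
    apply/seteqP; split=> m /=; first by move/(ind_JP (@Zhu_X_linear _ h k)).
    by move/(ind_JP (@Zhu_X_linear _ h k)).
  move=> ->; congr submod_gen; apply: eq_imagel => n /= /andP[n0 _].
  by rewrite -comb_Rseq.
move=> i i0 hi R' R'_deg sys'.
have Ri_deg := R_deg i i0 hi.
have hdeg : Uneg_deg (r * s) (R' - Rrs i).
  by rewrite addrC -scaleN1r; apply: Uneg_lin.
apply: (radical_degree_d hMh T_def S_deg S_sing hdeg) => p.
(* The two systems differ only in the unknown of index 1, which occurs only *)
(* in the first equation, undifferentiated.                                *)
set R1 := fun l => if l == i then R' else Rrs l in sys'.
have deg0 j : (1 <= j <= i.+1)%N -> Uneg_deg (r * s) (Rseq S Rrs i.+1 j).
  apply: Rseq_deg => l /andP[l0 li]; apply: R_deg => //.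
  exact: le_kappa_trans hi.
have deg1 j : (1 <= j <= i.+1)%N -> Uneg_deg (r * s) (Rseq S R1 i.+1 j).
  apply: Rseq_deg => l /andP[l0 li]; rewrite /R1; case: eqP => // _.
  by apply: R_deg => //; apply: le_kappa_trans hi.
have e0 := system_taylor F0 deg0 (R_sys i.+1 isT hi) p (isT : (1 <= 1 <= i.+1)%N).
have e1 := system_taylor F0 deg1 sys' p (isT : (1 <= 1 <= i.+1)%N).
have R1E j : (2 <= j < i.+2)%N -> Rseq S R1 i.+1 j = Rseq S Rrs i.+1 j.
  move=> /andP[j2 ji]; rewrite /Rseq /R1; case: eqP => // _.
  by rewrite ltn_eqF //; lia.
move: e1; rewrite -[in RHS]e0 !(@big_ltn _ _ _ 1) //= subnn !taylor0E.
rewrite !Rseq_lt // subSS subn0 {1}/R1 eqxx => e.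
have {}e : at2 c h (chi _ (dagger _ (pbw p) * R')) =
    at2 c h (chi _ (dagger _ (pbw p) * Rrs i)).
  apply: (addIr _ (etrans e _)); congr (_ + _); apply: eq_big_nat => j hj.
  by rewrite R1E.
by rewrite mulrBr linearB -scaleN1r addrC at2_linear e mulN1r addNr.
Qed.
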